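(* Let $\mathcal{N}^{(\tau)}=\left(\dot{\mathcal{P}}^{(\tau)},\{\dot{Q}_k^{(\tau)}\}_{k=1}^N,\{\dot{F}_k^{(\tau)}\}_{k=1}^N\right)$, $\tau=0,1,2,\ldots$, be a sequence generated by the alternating direction (LRQTC-NCTR) algorithm described in the context, for data $\dot{\mathcal{O}}\in\mathbb{H}^{I_1\times\cdots\times I_N}$, observed index set $\Omega$, weights $\alpha_k$, surrogate function $\phi_\gamma$ and penalty parameters $\beta_k^{(\tau)}$. Assume the $\beta$-convergence condition: for every $k=1,\ldots,N$, $$\sum_{\tau=1}^{\infty}\frac{\beta_k^{(\tau)}+\beta_k^{(\tau-1)}}{2\left(\beta_k^{(\tau-1)}\right)^2}<\infty .$$ Then any accumulation point $\mathcal{N}^{*}=\left(\dot{\mathcal{P}}^{*},\{\dot{Q}_k^{*}\}_{k=1}^N,\{\dot{F}_k^{*}\}_{k=1}^N\right)$ of the sequence satisfies the Karush-Kuhn-Tucker (KKT) conditions: (i) $\dot{P}_{[k]}^{*}=\dot{Q}_k^{*}$ for $k=1,\ldots,N$; (ii) $\dot{\mathcal{P}}^{*}_\Omega=\dot{\mathcal{O}}_\Omega$; (iii) $\dot{F}_k^{*}\in \alpha_k\,\partial\|\cdot\|_{\phi_\gamma}(\dot{Q}_k^{*})$ for $k=1,\ldots,N$.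
   Context: $\mathbb{H}$ is the real quaternion skew-field; $\mathfrak{R}(\cdot)$ is the real part, $\bar{\cdot}$ the conjugate, $|q|=\sqrt{q\bar q}$. For quaternion arrays of the same size, $\langle A,B\rangle=\sum \overline{A_{i_1\ldots i_N}}B_{i_1\ldots i_N}$ and $\|A\|_F=\sqrt{\langle A,A\rangle}$. For a tensor $\dot{\mathcal{P}}\in\mathbb{H}^{I_1\times\cdots\times I_N}$, $\dot{P}_{[k]}$ is its mode-$k$ unfolding: the $I_k\times\prod_{l\ne k}I_l$ matrix whose rows are indexed by $i_k$ and columns by the remaining indices (in a fixed ordering). For an index set $\Omega$ with complement $\Omega^C$, $\dot{\mathcal{P}}_\Omega$ keeps the entries in $\Omega$ and sets the others to zero. Singular values: every $\dot{Q}\in\mathbb{H}^{m\times n}$ has a quaternion SVD $\dot{Q}=\dot{U}S\dot{V}^H$ with $\dot{U},\dot{V}$ unitary and $S$ real rectangular diagonal with nonnegative diagonal entries $\sigma_i(\dot{Q})$. Define $\|\dot{Q}\|_{\phi_\gamma}=\sum_i\phi_\gamma(\sigma_i(\dot{Q}))$, where $\phi_\gamma$ on $[0,\infty)$ is any one of the following (with $\gamma>0$): Geman $\frac{(1+\gamma)x}{x+\gamma}$; Laplace $1-e^{-x/\gamma}$; logarithm $\log(\gamma+x)$; weighted nuclear norm $w_ix$; Schatten-$p$ $x^p$; weighted Schatten-$p$ $w_ix^p$ (with $0<p<1$, positive weights $w_i$, and $i$ the index of the singular value). All are concave and increasing on $[0,\infty)$. $\partial$ denotes the (limiting) subdifferential,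 quaternion matrices being viewed as a real Euclidean space with inner product $\mathfrak{R}\langle\cdot,\cdot\rangle$. Problem: given $\dot{\mathcal{O}}$, $\Omega$ and weights $\alpha_k\ge0$ with $\sum_k\alpha_k=1$, minimize $\sum_{k=1}^N\alpha_k\|\dot{Q}_k\|_{\phi_\gamma}$ over $\dot{\mathcal{P}}$ and matrices $\dot{Q}_k$ (of the size of $\dot{P}_{[k]}$) subject to $\dot{P}_{[k]}=\dot{Q}_k$ $(k=1,\ldots,N)$ and $\dot{\mathcal{P}}_\Omega=\dot{\mathcal{O}}_\Omega$. The augmented Lagrangian is $$\mathfrak{L}=\sum_{k=1}^N\left(\alpha_k\|\dot{Q}_k\|_{\phi_\gamma}+\mathfrak{R}\langle\dot{F}_k,\dot{P}_{[k]}-\dot{Q}_k\rangle+\frac{\beta_k}{2}\|\dot{P}_{[k]}-\dot{Q}_k\|_F^2\right).$$ Algorithm (LRQTC-NCTR): start from some $\dot{Q}_k^{(0)},\dot{F}_k^{(0)}$ and $\beta_k^{(0)}>0$, with $\rho>1$ and $\beta^{\max}\in(0,+\infty]$. For $\tau=0,1,2,\ldots$: 1. let $\dot{\mathcal{P}}'$ be the minimizer over $\dot{\mathcal{P}}$ of $\sum_k\frac{\beta_k^{(\tau)}}{2}\left\|\dot{P}_{[k]}-\dot{Q}_k^{(\tau)}+\frac{1}{\beta_k^{(\tau)}}\dot{F}_k^{(\tau)}\right\|_F^2$, and set $\dot{\mathcal{P}}^{(\tau+1)}=\dot{\mathcal{P}}'_{\Omega^C}+\dot{\mathcal{O}}_\Omega$;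 2. for each $k$, $\dot{Q}_k^{(\tau+1)}\in\arg\min_{\dot{Q}_k}\ \alpha_k\|\dot{Q}_k\|_{\phi_\gamma}+\frac{\beta_k^{(\tau)}}{2}\left\|\dot{P}_{[k]}^{(\tau+1)}-\dot{Q}_k+\frac{1}{\beta_k^{(\tau)}}\dot{F}_k^{(\tau)}\right\|_F^2$; 3. for each $k$, $\dot{F}_k^{(\tau+1)}=\dot{F}_k^{(\tau)}-\beta_k^{(\tau)}\left(\dot{Q}_k^{(\tau+1)}-\dot{P}_{[k]}^{(\tau+1)}\right)$; 4. $\beta_k^{(\tau+1)}=\min(\beta^{\max},\rho\beta_k^{(\tau)})$ (so $\beta_k^{(\tau+1)}=\rho\beta_k^{(\tau)}$ when $\beta^{\max}=+\infty$). *)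

(* Defs.v *)
From HB Require Import structures.
From mathcomp Require Import all_boot all_order all_algebra.
From mathcomp Require Import all_classical all_reals all_analysis.
From mathcomp Require Import ring.

Set Implicit Arguments.
Unset Strict Implicit.
Unset Printing Implicit Defensive.

Import Order.TTheory GRing.Theory Num.Theory.
Import numFieldNormedType.Exports.

Local Open Scope classical_set_scope.
Local Open Scope ring_scope.

Record quat (R : Type) := Quat { q1 : R; qi : R; qj : R; qk : R }.

Section QuaternionRing.
Variable R : comNzRingType.
Implicit Types x y z : quat R.

Definition quat_tuple x := (q1 x, qi x, qj x, qk x).
Definition tuple_quat (t : R * R * R * R) : quat R :=
  let: (a, b, c, d) := t in Quat a b c d.
Lemma quat_tupleK : cancel quat_tuple tuple_quat.
Proof. by case. Qed.

HB.instance Definition _ := Choice.copy (quat R) (can_type quat_tupleK).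

Definition addq x y :=
  Quat (q1 x + q1 y) (qi x + qi y) (qj x + qj y) (qk x + qk y).
Definition oppq x := Quat (- q1 x) (- qi x) (- qj x) (- qk x).

(* the embedding of the scalars *)
Definition realq (a : R) : quat R := Quat a 0 0 0.

Lemma addqA : associative addq.
Proof. by move=> x y z; rewrite /addq /= !addrA. Qed.
Lemma addqC : commutative addq.
Proof. by move=> x y; congr Quat; rewrite addrC. Qed.
Lemma add0q : left_id (realq 0) addq.
Proof. by case=> a b c d; rewrite /addq /= !add0r. Qed.
Lemma addNq : left_inverse (realq 0) oppq addq.
Proof. by move=> x; rewrite /addq /= !addNr. Qed.

HB.instance Definition _ :=
  GRing.isZmodule.Build (quat R) addqA addqC add0q addNq.

Definition mulq x y := Quat
  (q1 x * q1 y - qi x * qi y - qj x * qj y - qk x * qk y)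
  (q1 x * qi y + qi x * q1 y + qj x * qk y - qk x * qj y)
  (q1 x * qj y - qi x * qk y + qj x * q1 y + qk x * qi y)
  (q1 x * qk y + qi x * qj y - qj x * qi y + qk x * q1 y).

Lemma mulqA : associative mulq.
Proof. by move=> x y z; congr Quat => /=; ring. Qed.
Lemma mul1q : left_id (realq 1) mulq.
Proof. by case=> a b c d; congr Quat => /=; ring. Qed.
Lemma mulq1 : right_id (realq 1) mulq.
Proof. by case=> a b c d; congr Quat => /=; ring. Qed.
Lemma mulqDl : left_distributive mulq addq.
Proof. by move=> x y z; congr Quat => /=; ring. Qed.
Lemma mulqDr : right_distributive mulq addq.
Proof. by move=> x y z; congr Quat => /=; ring. Qed.
Lemma oneq_neq0 : realq 1 != 0.
Proof. by apply/eqP => -[] /eqP; rewrite oner_eq0. Qed.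

HB.instance Definition _ := GRing.Zmodule_isNzRing.Build (quat R)
  mulqA mul1q mulq1 mulqDl mulqDr oneq_neq0.

Definition conjq x : quat R := Quat (q1 x) (- qi x) (- qj x) (- qk x).

End QuaternionRing.

Section QuaternionMatrices.
Variable R : realType.
Local Notation H := (quat R).

Definition mxinner m n (A B : 'M[H]_(m, n)) : H :=
  \sum_i \sum_j conjq (A i j) * B i j.

Definition mxfrob m n (A : 'M[H]_(m, n)) : R := Num.sqrt (q1 (mxinner A A)).

Definition ctrmx m n (A : 'M[H]_(m, n)) : 'M[H]_(n, m) := map_mx (@conjq R) A^T.

Definition is_unitary n (U : 'M[H]_n) : Prop :=
  U *m ctrmx U = 1%:M /\ ctrmx U *m U = 1%:M.

Definition rdiagmx m n (s : 'rV[R]_(minn m n)) : 'M[H]_(m, n) :=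
  \matrix_(i, j) \sum_(l < minn m n | (l == i :> nat) && (l == j :> nat))
    realq (s 0 l).

Definition is_singular_values m n (A : 'M[H]_(m, n)) (s : 'rV[R]_(minn m n)) :=
  [/\ forall i, 0 <= s 0 i,
      forall i j : 'I_(minn m n), (i <= j)%N -> s 0 j <= s 0 i
    & exists U : 'M[H]_m, exists V : 'M[H]_n,
        [/\ is_unitary U, is_unitary V & A = U *m rdiagmx s *m ctrmx V]].

(* Every quaternion matrix has exactly one such s, so the default value 0 of
   xget is never used. *)
Definition singular_values m n (A : 'M[H]_(m, n)) : 'rV[R]_(minn m n) :=
  xget 0 [set s | is_singular_values A s].

(* Quaternion matrices are a real Euclidean space for q1 (mxinner _ _); its
   norm is mxfrob. *)
Definition frechet_subdiff m n (f : 'M[H]_(m, n) -> R) (X : 'M[H]_(m, n)) :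
    set 'M[H]_(m, n) :=
  [set V | forall e : R, 0 < e -> exists2 d : R, 0 < d &
     forall Y, mxfrob (Y - X) < d ->
       f X + q1 (mxinner V (Y - X)) - e * mxfrob (Y - X) <= f Y].

Definition mxcvg m n (X : nat -> 'M[H]_(m, n)) (L : 'M[H]_(m, n)) : Prop :=
  mxfrob (X j - L) @[j --> \oo] --> (0 : R).

Definition limiting_subdiff m n (f : 'M[H]_(m, n) -> R) (X : 'M[H]_(m, n)) :
    set 'M[H]_(m, n) :=
  [set V | exists Xs : nat -> 'M[H]_(m, n), exists Vs : nat -> 'M[H]_(m, n),
     [/\ mxcvg Xs X, f (Xs j) @[j --> \oo] --> f X,
         forall j, frechet_subdiff f (Xs j) (Vs j) & mxcvg Vs V]].

End QuaternionMatrices.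

Variant surrogate (R : Type) :=
  | Geman
  | Laplace
  | Logarithm
  | WeightedNuclear of nat -> R
  | Schatten of R
  | WeightedSchatten of (nat -> R) & R.
Arguments Geman {R}.
Arguments Laplace {R}.
Arguments Logarithm {R}.

Section Surrogate.
Variable R : realType.

Definition surrogate_ok (f : surrogate R) : Prop :=
  match f with
  | Geman | Laplace | Logarithm => True
  | WeightedNuclear w => forall i, 0 < w i
  | Schatten p => 0 < p < 1
  | WeightedSchatten w p => (forall i, 0 < w i) /\ 0 < p < 1
  end.

(* i is the index of the singular value x, counted from 0 *)
Definition surrogate_fun (f : surrogate R) (gamma : R) (i : nat) (x : R) : R :=
  match f with
  | Geman => (1 + gamma) * x / (x + gamma)
  | Laplace => 1 - expR (- x / gamma)
  | Logarithm => ln (gamma + x)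
  | WeightedNuclear w => w i * x
  | Schatten p => x `^ p
  | WeightedSchatten w p => w i * x `^ p
  end.

Definition surrogate_norm (f : surrogate R) (gamma : R) m n
    (A : 'M[quat R]_(m, n)) : R :=
  \sum_(i < minn m n) surrogate_fun f gamma i (singular_values A 0 i).

End Surrogate.
Arguments surrogate_norm {R} f gamma {m n} A.

Section Tensors.
Variables (R : realType) (N : nat) (I : 'I_N -> nat).
Local Notation H := (quat R).

Definition mindex := {dffun forall k : 'I_N, 'I_(I k)}.

Definition tensor := {ffun mindex -> H}.

Definition coindex (k : 'I_N) :=
  {dffun forall l : {l : 'I_N | l != k}, 'I_(I (val l))}.

Lemma card_coindex k : #|coindex k| = (\prod_(l < N | l != k) I l)%N.
Proof.
rewrite card_dep_ffun foldrE big_map big_enum /=.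
under eq_bigr do rewrite card_ord.
rewrite (reindex_omap (op := muln) (P := fun l => l != k)
  (val : {l : 'I_N | l != k} -> 'I_N) insub) //=.
  by apply: eq_bigl => l; rewrite (valP l) valK eqxx.
by move=> l lk; rewrite insubT.
Qed.

Definition join_index k (a : 'I_(I k)) (r : coindex k) : mindex :=
  [ffun l => match eqVneq l k with
             | EqNotNeq e => ecast l 'I_(I l) (esym e) a
             | NeqNotEq ne => r (Sub l ne)
             end].

Lemma join_index_same k a (r : coindex k) : join_index a r k = a.
Proof.
rewrite ffunE; case: eqVneq => [e|ne]; first by rewrite (eq_axiomK (esym e)).
by exfalso; rewrite eqxx in ne.
Qed.

Lemma join_index_other k a (r : coindex k) (l : {l : 'I_N | l != k}) :
  join_index a r (val l) = r l.
Proof.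
case: l => l lk; rewrite ffunE /=; case: eqVneq => [e|ne].
  by exfalso; rewrite e eqxx in lk.
by rewrite (bool_irrelevance ne lk).
Qed.

(* Mode-k unfolding; its column index ranges over the enumeration of the
   multi-indices in which the k-th entry is left out. *)
Definition unfold k (P : tensor) : 'M[H]_(I k, #|coindex k|) :=
  \matrix_(a, c) P (join_index a (enum_val c)).

Definition tproj (Omega : {set mindex}) (P : tensor) : tensor :=
  [ffun i => if i \in Omega then P i else 0].

Definition tfrob (P : tensor) : R :=
  Num.sqrt (q1 (\sum_i conjq (P i) * P i)).

Definition tcvg (X : nat -> tensor) (L : tensor) : Prop :=
  tfrob (X j - L) @[j --> \oo] --> (0 : R).

End Tensors.

Section Algorithm.
Variables (R : realType) (N : nat) (I : 'I_N -> nat).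
Local Notation H := (quat R).
Local Notation umx k := 'M[H]_(I k, #|coindex I k|).

Definition is_argmin T (f : T -> R) (x : T) : Prop := forall y, f x <= f y.

Record lrqtc_nctr (O : tensor R I) (Omega : {set mindex I}) (alpha : 'I_N -> R)
    (phi : surrogate R) (gamma rho : R) (bmax : \bar R)
    (P : nat -> tensor R I) (Q F : forall k : 'I_N, nat -> umx k)
    (beta : 'I_N -> nat -> R) : Prop := LrqtcNctr {
  beta0_gt0 : forall k, 0 < beta k 0%N ;
  step_P : forall t, exists2 P' : tensor R I,
    is_argmin (fun X : tensor R I => \sum_k beta k t / 2 *
      mxfrob (unfold k X - Q k t + realq (beta k t)^-1 *: F k t) ^+ 2) P'
    & P t.+1 = tproj (~: Omega) P' + tproj Omega O ;
  step_Q : forall t k,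
    is_argmin (fun X : umx k => alpha k * surrogate_norm phi gamma X +
      beta k t / 2 *
      mxfrob (unfold k (P t.+1) - X + realq (beta k t)^-1 *: F k t) ^+ 2)
      (Q k t.+1) ;
  step_F : forall t k,
    F k t.+1 = F k t - realq (beta k t) *: (Q k t.+1 - unfold k (P t.+1)) ;
  step_beta : forall t k,
    (beta k t.+1)%:E = Order.min bmax (rho * beta k t)%:E
}.

Definition accumulation_point (P : nat -> tensor R I)
    (Q F : forall k : 'I_N, nat -> umx k)
    (Ps : tensor R I) (Qs Fs : forall k : 'I_N, umx k) : Prop :=
  exists2 u : nat -> nat, {homo u : a b / (a < b)%N} &
    [/\ tcvg (P \o u) Ps,
        forall k, mxcvg (Q k \o u) (Qs k)
      & forall k, mxcvg (F k \o u) (Fs k)].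

End Algorithm.

(* Main.v *)
Require Import Defs.
From mathcomp Require Import all_boot all_order all_algebra perm.
From mathcomp Require Import all_classical all_reals all_analysis.
From mathcomp Require Import ring lra.

Import Order.TTheory GRing.Theory Num.Theory.
Import numFieldNormedType.Exports.
(* Again, because MathComp has its own [is_unitary]. *)
Import Defs.

Local Open Scope classical_set_scope.
Local Open Scope ring_scope.

Set Implicit Arguments.
Unset Strict Implicit.

(* With D_t = P_[k]^(t+1) + F_k^t / beta_t - Q_k^(t+1), the multiplier update reads
   F_k^(t+1) = beta_t D_t, and optimality of the Q-step says that F_k^(t+1) is
   alpha_k times a Frechet subgradient at Q_k^(t+1); (iii) is then the closedness
   of the limiting subdifferential, once the surrogate norm is known to be
   continuous.  The beta-convergence condition excludes a finite cap beta^max, so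
   that beta_(t+1) = rho beta_t tends to infinity.  Comparing Q_k^(t+1) with the
   centre of the proximal term gives beta_t |D_t|^2 = O(1 + |D_t|), hence D_t -> 0
   without any bound on the multipliers, and the feasibility gap
   P_[k]^(t+1) - Q_k^(t+1) = D_t - D_(t-1) / rho tends to 0, which is (i).

   When alpha_k = 0, (iii) still asks for some limiting subgradient, although for
   x^p the surrogate norm is not locally Lipschitz at matrices of deficient rank.
   It satisfies the one-sided bound f(X) - f(Y) <= L_X |X - Y|, so minimisers of
   f + n |. - X|^2 lie within L_X / n of X, and their bounded Frechet subgradients
   accumulate.

   Continuity of the singular values comes from the Ky Fan maximum principle, and
   their existence from maximising Re tr (U^H A V D^H) over the compact set of pairs
   of unitary matrices, for a fixed diagonal D with decreasing entries. *)

(** * Quaternion arithmetic: conjugation, real part and modulus *)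

Section Quaternions.
Variable R : realType.
Implicit Types x y z : quat R.

Definition sqnormq x : R := q1 x ^+ 2 + qi x ^+ 2 + qj x ^+ 2 + qk x ^+ 2.

Definition absq x : R := Num.sqrt (sqnormq x).

Lemma quat_eq x y :
  q1 x = q1 y -> qi x = qi y -> qj x = qj y -> qk x = qk y -> x = y.
Proof. by case: x => ????; case: y => ???? /= -> -> -> ->. Qed.

Lemma q1D x y : q1 (x + y) = q1 x + q1 y. Proof. by []. Qed.

Lemma q1_sum (J : Type) (r : seq J) (p : pred J) (E : J -> quat R) :
  q1 (\sum_(i <- r | p i) E i) = \sum_(i <- r | p i) q1 (E i).
Proof. exact: (big_morph (@q1 R) q1D). Qed.

Lemma q1_mulC x y : q1 (x * y) = q1 (y * x).
Proof. by rewrite /=; ring. Qed.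

Lemma q1_conjM x : q1 (conjq x * x) = sqnormq x.
Proof. by rewrite /sqnormq /=; ring. Qed.

Lemma conjqK : involutive (@conjq R).
Proof. by move=> [a b c d]; rewrite /conjq /= !opprK. Qed.

Lemma conjqD x y : conjq (x + y) = conjq x + conjq y.
Proof. by apply: quat_eq => //=; ring. Qed.

Lemma conjqN x : conjq (- x) = - conjq x.
Proof. by apply: quat_eq => //=; ring. Qed.

Lemma conjqM x y : conjq (x * y) = conjq y * conjq x.
Proof. by apply: quat_eq => /=; ring. Qed.

Lemma conjq_real (a : R) : conjq (realq a) = realq a.
Proof. by rewrite /conjq /realq /= !oppr0. Qed.

Lemma conjq0 : conjq (0 : quat R) = 0. Proof. exact: conjq_real. Qed.
Lemma conjq1 : conjq (1 : quat R) = 1. Proof. exact: conjq_real. Qed.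

Lemma conjq_sum (J : Type) (r : seq J) (p : pred J) (E : J -> quat R) :
  conjq (\sum_(i <- r | p i) E i) = \sum_(i <- r | p i) conjq (E i).
Proof. exact: (big_morph (@conjq R) conjqD conjq0). Qed.

Lemma realqC (a : R) x : realq a * x = x * realq a.
Proof. by apply: quat_eq => /=; ring. Qed.

Lemma realqM (a b : R) : realq a * realq b = realq (a * b).
Proof. by apply: quat_eq => /=; ring. Qed.

Lemma realqD (a b : R) : realq (a + b) = realq a + realq b.
Proof. by apply: quat_eq => /=; rewrite ?addr0. Qed.

Lemma mulq_conj x : x * conjq x = realq (sqnormq x).
Proof. by apply: quat_eq => /=; rewrite /sqnormq; ring. Qed.

Lemma mulconjq x : conjq x * x = realq (sqnormq x).
Proof. by apply: quat_eq => /=; rewrite /sqnormq; ring. Qed.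

Lemma sqnormq_ge0 x : 0 <= sqnormq x.
Proof. by rewrite /sqnormq !addr_ge0 ?sqr_ge0. Qed.

Lemma absq_ge0 x : 0 <= absq x. Proof. exact: sqrtr_ge0. Qed.

Lemma sqr_absq x : absq x ^+ 2 = sqnormq x.
Proof. by rewrite sqr_sqrtr ?sqnormq_ge0. Qed.

Lemma sqnormqM x y : sqnormq (x * y) = sqnormq x * sqnormq y.
Proof. by rewrite /sqnormq /=; ring. Qed.

Lemma absqM x y : absq (x * y) = absq x * absq y.
Proof. by rewrite /absq sqnormqM sqrtrM ?sqnormq_ge0. Qed.

Lemma sqnormq_conj x : sqnormq (conjq x) = sqnormq x.
Proof. by rewrite /sqnormq /= !sqrrN. Qed.

Lemma absq_conj x : absq (conjq x) = absq x.
Proof. by rewrite /absq sqnormq_conj. Qed.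

Lemma sqnormqN x : sqnormq (- x) = sqnormq x.
Proof. by rewrite /sqnormq /= !sqrrN. Qed.

Lemma sqnormq_real (a : R) : sqnormq (realq a) = a ^+ 2.
Proof. by rewrite /sqnormq /=; ring. Qed.

Lemma sqnormq_eq0 x : (sqnormq x == 0) = (x == 0).
Proof.
apply/eqP/eqP => [|->]; last by rewrite /sqnormq /= expr0n /= !addr0.
rewrite /sqnormq => /eqP.
rewrite !paddr_eq0 ?addr_ge0 ?sqr_ge0 // !sqrf_eq0.
by move=> /andP[/andP[/andP[/eqP ? /eqP ?] /eqP ?] /eqP ?]; exact: quat_eq.
Qed.

Lemma absq_eq0 x : (absq x == 0) = (x == 0).
Proof. by rewrite -sqnormq_eq0 -sqr_absq sqrf_eq0. Qed.

Lemma normr_le_absq x :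
  [/\ `|q1 x| <= absq x, `|qi x| <= absq x, `|qj x| <= absq x
    & `|qk x| <= absq x].
Proof.
have := (sqr_ge0 (q1 x), sqr_ge0 (qi x), sqr_ge0 (qj x), sqr_ge0 (qk x)).
move=> [[[? ?] ?] ?].
by split; rewrite -sqrtr_sqr ler_wsqrtr // /sqnormq; lra.
Qed.

Lemma q1_le_absq x : q1 x <= absq x.
Proof. by case: (normr_le_absq x) => + _ _ _; exact/le_trans/ler_norm. Qed.

Lemma q1_conjM_le x y : q1 (conjq x * y) <= absq x * absq y.
Proof. by rewrite -(absq_conj x) -absqM q1_le_absq. Qed.

Lemma ler_absqD x y : absq (x + y) <= absq x + absq y.
Proof.
rewrite -(@ler_pXn2r _ 2) ?nnegrE ?addr_ge0 ?absq_ge0 // sqrrD !sqr_absq.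
have := q1_conjM_le x y.
have -> : sqnormq (x + y) = sqnormq x + q1 (conjq x * y) *+ 2 + sqnormq y.
  by rewrite /sqnormq /=; ring.
lra.
Qed.

End Quaternions.

(** * The real inner product and the Frobenius norm *)

Section Frobenius.
Variable R : realType.
Local Notation H := (quat R).

Lemma q1_mxinner m n (A B : 'M[H]_(m, n)) :
  q1 (mxinner A B) = \sum_i \sum_j q1 (conjq (A i j) * B i j).
Proof. by rewrite q1_sum; apply: eq_bigr => i _; rewrite q1_sum. Qed.

Lemma mxfrob_ge0 m n (A : 'M[H]_(m, n)) : 0 <= mxfrob A.
Proof. exact: sqrtr_ge0. Qed.

Lemma q1_mxinner_ge0 m n (A : 'M[H]_(m, n)) : 0 <= q1 (mxinner A A).
Proof.
by rewrite q1_mxinner; apply: sumr_ge0 => i _; apply: sumr_ge0 => j _;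
  rewrite q1_conjM sqnormq_ge0.
Qed.

Lemma mxfrob_sqr m n (A : 'M[H]_(m, n)) : mxfrob A ^+ 2 = q1 (mxinner A A).
Proof. by rewrite sqr_sqrtr ?q1_mxinner_ge0. Qed.

Lemma mxfrob_sqrE m n (A : 'M[H]_(m, n)) :
  mxfrob A ^+ 2 = \sum_i \sum_j sqnormq (A i j).
Proof.
rewrite mxfrob_sqr q1_mxinner.
by under eq_bigr do under eq_bigr do rewrite q1_conjM.
Qed.

Lemma mxfrob_sqrtE m n (A : 'M[H]_(m, n)) :
  mxfrob A = Num.sqrt (\sum_i \sum_j sqnormq (A i j)).
Proof. by rewrite -mxfrob_sqrE sqrtr_sqr ger0_norm ?mxfrob_ge0. Qed.

Lemma absq_le_mxfrob m n (A : 'M[H]_(m, n)) i j : absq (A i j) <= mxfrob A.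
Proof.
rewrite -(@ler_pXn2r _ 2) ?nnegrE ?absq_ge0 ?mxfrob_ge0 // sqr_absq mxfrob_sqrE.
rewrite (bigD1 i) //= (bigD1 j) //= -addrA lerDl addr_ge0 //.
  by apply: sumr_ge0 => *; exact: sqnormq_ge0.
by apply: sumr_ge0 => *; apply: sumr_ge0 => *; exact: sqnormq_ge0.
Qed.

Lemma mxfrob_sqrD m n (A B : 'M[H]_(m, n)) : mxfrob (A + B) ^+ 2 =
  mxfrob A ^+ 2 + 2 * q1 (mxinner A B) + mxfrob B ^+ 2.
Proof.
rewrite !mxfrob_sqr !q1_mxinner mulr_sumr -!big_split /=.
apply: eq_bigr => i _; rewrite mulr_sumr -!big_split /=.
by apply: eq_bigr => j _; rewrite mxE /=; ring.
Qed.

Lemma q1_mxinnerZl m n (c : R) (A B : 'M[H]_(m, n)) :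
  q1 (mxinner (realq c *: A) B) = c * q1 (mxinner A B).
Proof.
rewrite !q1_mxinner mulr_sumr; apply: eq_bigr => i _.
by rewrite mulr_sumr; apply: eq_bigr => j _; rewrite mxE /=; ring.
Qed.

Lemma mxfrobZ m n (c : R) (A : 'M[H]_(m, n)) :
  mxfrob (realq c *: A) = `|c| * mxfrob A.
Proof.
rewrite /mxfrob q1_mxinnerZl -sqrtr_sqr -sqrtrM ?sqr_ge0 // !q1_mxinner.
congr Num.sqrt; rewrite !mulr_sumr; apply: eq_bigr => i _.
by rewrite !mulr_sumr; apply: eq_bigr => j _; rewrite mxE /=; ring.
Qed.

Lemma mxfrob0 m n : mxfrob (0 : 'M[H]_(m, n)) = 0.
Proof.
apply/eqP; rewrite -sqrf_eq0 mxfrob_sqrE big1 // => i _.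
by rewrite big1 // => j _; rewrite mxE; apply/eqP; rewrite sqnormq_eq0.
Qed.

Lemma mxfrobN m n (A : 'M[H]_(m, n)) : mxfrob (- A) = mxfrob A.
Proof.
rewrite /mxfrob !q1_mxinner; congr Num.sqrt.
by apply: eq_bigr => i _; apply: eq_bigr => j _; rewrite mxE /=; ring.
Qed.

Lemma mxfrobB m n (A B : 'M[H]_(m, n)) : mxfrob (A - B) = mxfrob (B - A).
Proof. by rewrite -mxfrobN opprB. Qed.

Lemma mxfrob_eq0 m n (A : 'M[H]_(m, n)) : mxfrob A = 0 -> A = 0.
Proof.
move=> A0; apply/matrixP => i j; rewrite mxE; apply/eqP.
by rewrite -absq_eq0 eq_le absq_ge0 andbT -A0 absq_le_mxfrob.
Qed.

Lemma scale_realqA m n a b (A : 'M[H]_(m, n)) :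
  realq a *: (realq b *: A) = realq (a * b) *: A.
Proof. by rewrite scalerA realqM. Qed.

End Frobenius.

(** * Convergence of sequences and sequential compactness *)

Section Sequences.
Variable R : realType.
Local Notation H := (quat R).

Lemma subseq_ge (u : nat -> nat) :
  {homo u : a b / (a < b)%N} -> forall j, (j <= u j)%N.
Proof. by move=> u_incr; elim=> // j /leq_ltn_trans; apply; exact: u_incr. Qed.

Lemma cvg_subseq_oo (u : nat -> nat) :
  {homo u : a b / (a < b)%N} -> u j @[j --> \oo] --> \oo.
Proof.
move=> u_incr; apply/cvgnyPge => A; near=> j.
by apply: leq_trans (subseq_ge u_incr j); near: j; exact: nbhs_infty_ge.
Unshelve. all: by end_near. Qed.

Lemma cvg_dist_le (x e : nat -> R) (l : R) :
  (forall j, `|x j - l| <= e j) -> e j @[j --> \oo] --> (0 : R) ->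
  x j @[j --> \oo] --> l.
Proof.
move=> xe e0; apply/cvgrPdist_lt => d d0.
move/cvgrPdist_lt/(_ d d0) : e0; apply: filterS => j; rewrite sub0r normrN.
by rewrite distrC => /(le_lt_trans (ler_norm _)); exact/le_lt_trans.
Qed.

Lemma cvg_real_unique (x : nat -> R) (l l' : R) :
  x j @[j --> \oo] --> l -> x j @[j --> \oo] --> l' -> l = l'.
Proof. exact: (@cvg_unique _ (@norm_hausdorff _ _)). Qed.

Lemma cvg_sqrt (x : nat -> R) (l : R) : x j @[j --> \oo] --> l ->
  Num.sqrt (x j) @[j --> \oo] --> Num.sqrt l.
Proof. by move=> xl; apply: (cvg_comp x Num.sqrt xl); exact: sqrt_continuous. Qed.

Lemma cvg_sum_real (T : Type) (r : seq T) (x : T -> nat -> R) (l : T -> R) :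
  (forall i, x i j @[j --> \oo] --> l i) ->
  \sum_(i <- r) x i j @[j --> \oo] --> \sum_(i <- r) l i.
Proof.
move=> xl; elim: r => [|i r IH].
  by under eq_fun do rewrite big_nil; rewrite big_nil; exact: cvg_cst.
by under eq_fun do rewrite big_cons; rewrite big_cons; exact: cvgD.
Qed.

(** Induction on the list of coordinates, each one refining the subsequence already extracted. *)
Lemma bolzano_weierstrass_finite (T : eqType) (s : seq T) (x : nat -> T -> R) C :
  (forall j i, `|x j i| <= C) ->
  exists2 u : nat -> nat, {homo u : a b / (a < b)%N} &
    exists l : T -> R, {in s, forall i, x (u j) i @[j --> \oo] --> l i}.
Proof.
move=> xC; elim: s => [|i s [u u_incr [l xl]]].
  by exists id => //; exists (fun=> 0).
have /bolzano_weierstrass[v v_incr /cvg_ex[li xli]] :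
    bounded_fun (fun j => x (u j) i).
  exists C; split; first exact: num_real.
  by move=> M CM j _ /=; exact: le_trans (xC _ _) (ltW CM).
have {}v_incr : {homo v : a b / (a < b)%N}.
  move=> a b; rewrite !ltnNge; apply: contraNN.
  by have := v_incr b a; rewrite -!leEnat => ->.
exists (u \o v) => [a b ab|]; first exact/u_incr/v_incr.
exists (fun k => if k == i then li else l k) => k; rewrite inE.
case: eqVneq => [->|_ /= ks] //.
exact: (cvg_comp _ _ (cvg_subseq_oo v_incr) (xl k ks)).
Qed.

(** Stated on the four real coordinates so that limit laws reduce to those of [R]; [qcvg_absq]
    identifies it with convergence in modulus. *)
Definition qcvg (x : nat -> H) (l : H) := [/\ q1 (x j) @[j --> \oo] --> q1 l,
  qi (x j) @[j --> \oo] --> qi l, qj (x j) @[j --> \oo] --> qj l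
  & qk (x j) @[j --> \oo] --> qk l].

Lemma qcvgD x y l l' : qcvg x l -> qcvg y l' -> qcvg (fun j => x j + y j) (l + l').
Proof. by move=> [????] [????]; split; apply: cvgD. Qed.

Lemma qcvgN x l : qcvg x l -> qcvg (fun j => - x j) (- l).
Proof. by move=> [????]; split; apply: cvgN. Qed.

Lemma qcvgM x y l l' : qcvg x l -> qcvg y l' -> qcvg (fun j => x j * y j) (l * l').
Proof.
move=> [????] [????]; split=> /=.
- by apply: cvgB; [apply: cvgB; [apply: cvgB|]|]; exact: cvgM.
- by apply: cvgB; [apply: cvgD; [apply: cvgD|]|]; exact: cvgM.
- by apply: cvgD; [apply: cvgD; [apply: cvgB|]|]; exact: cvgM.
- by apply: cvgD; [apply: cvgB; [apply: cvgD|]|]; exact: cvgM.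
Qed.

Lemma qcvg_conj x l : qcvg x l -> qcvg (fun j => conjq (x j)) (conjq l).
Proof. by move=> [????]; split=> //; apply: cvgN. Qed.

Lemma qcvg_cst l : qcvg (fun=> l) l.
Proof. by split; exact: cvg_cst. Qed.

Lemma qcvg_sum (T : Type) (r : seq T) (x : T -> nat -> H) (l : T -> H) :
  (forall i, qcvg (x i) (l i)) ->
  qcvg (fun j => \sum_(i <- r) x i j) (\sum_(i <- r) l i).
Proof.
move=> xl; elim: r => [|i r IH].
  by under eq_fun do rewrite big_nil; rewrite big_nil; exact: qcvg_cst.
by under eq_fun do rewrite big_cons; rewrite big_cons; exact: qcvgD.
Qed.

Lemma qcvg_unique x l l' : qcvg x l -> qcvg x l' -> l = l'.
Proof.
move=> [a b c d] [a' b' c' d'].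
apply: quat_eq.
- exact: cvg_real_unique a a'.
- exact: cvg_real_unique b b'.
- exact: cvg_real_unique c c'.
- exact: cvg_real_unique d d'.
Qed.

Lemma qcvg_absq x l : qcvg x l <-> absq (x j - l) @[j --> \oo] --> (0 : R).
Proof.
split=> [[x1 xi xj xk]|x0].
- rewrite -[0]sqrtr0; apply: cvg_sqrt.
  have sqr0 (y : nat -> R) (l' : R) : y j @[j --> \oo] --> l' ->
      (y j - l') ^+ 2 @[j --> \oo] --> (0 : R).
    by move=> /subr_cvg0 y0; rewrite -[0](mulr0 0); exact: cvgM.
  have -> : 0 = 0 + 0 + 0 + 0 :> R by rewrite !addr0.
  apply: cvgD; [apply: cvgD; [apply: cvgD|]|]; exact: sqr0.
- have bnd j := normr_le_absq (x j - l).
  by split; apply: cvg_dist_le x0 => j; case: (bnd j).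
Qed.

Section Matrices.
Variables m n : nat.
Implicit Types (X Y : nat -> 'M[H]_(m, n)) (L : 'M[H]_(m, n)).

Lemma mxcvgP X L : mxcvg X L <-> forall a b, qcvg (fun j => X j a b) (L a b).
Proof.
split=> [XL a b|XL].
- apply/qcvg_absq; apply: cvg_dist_le XL => j.
  rewrite subr0 ger0_norm ?absq_ge0 //.
  by have := absq_le_mxfrob (X j - L) a b; rewrite !mxE.
- rewrite /mxcvg -[0]sqrtr0.
  under eq_fun do rewrite mxfrob_sqrtE.
  apply: cvg_sqrt.
  rewrite [X in _ --> X](_ : 0 = \sum_(i < m) \sum_(i' < n) (0 : R)); last first.
    by rewrite big1 // => i _; rewrite big1.
  apply: cvg_sum_real => a; apply: cvg_sum_real => b.
  under eq_fun do rewrite !mxE -sqr_absq.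
  by rewrite -[0](mulr0 0); apply: cvgM; apply/qcvg_absq.
Qed.

Lemma mxcvg_unique X L L' : mxcvg X L -> mxcvg X L' -> L = L'.
Proof.
move=> /mxcvgP XL /mxcvgP XL'; apply/matrixP => a b.
exact: qcvg_unique (XL a b) (XL' a b).
Qed.

Lemma mxcvg_cst L : mxcvg (fun=> L) L.
Proof. by apply/mxcvgP => a b; exact: qcvg_cst. Qed.

Lemma mxcvgD X Y L (L' : 'M[H]_(m, n)) :
  mxcvg X L -> mxcvg Y L' -> mxcvg (fun j => X j + Y j) (L + L').
Proof.
move=> /mxcvgP XL /mxcvgP YL; apply/mxcvgP => a b.
by under eq_fun do rewrite mxE; rewrite mxE; exact: qcvgD.
Qed.

Lemma mxcvgN X L : mxcvg X L -> mxcvg (fun j => - X j) (- L).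
Proof.
move=> /mxcvgP XL; apply/mxcvgP => a b.
by under eq_fun do rewrite mxE; rewrite mxE; exact: qcvgN.
Qed.

Lemma mxcvgZ X L c : mxcvg X L -> mxcvg (fun j => realq c *: X j) (realq c *: L).
Proof.
move=> /mxcvgP XL; apply/mxcvgP => a b.
by under eq_fun do rewrite mxE; rewrite mxE; apply: qcvgM => //; exact: qcvg_cst.
Qed.

Lemma mxcvg_subseq X L (u : nat -> nat) :
  {homo u : a b / (a < b)%N} -> mxcvg X L -> mxcvg (X \o u) L.
Proof. by move=> /cvg_subseq_oo u_oo XL; exact: (cvg_comp _ _ u_oo XL). Qed.

Lemma mx_bolzano_weierstrass X C : (forall j, mxfrob (X j) <= C) ->
  exists2 u : nat -> nat, {homo u : a b / (a < b)%N} &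
    exists L, mxcvg (X \o u) L.
Proof.
move=> XC.
pose x j (i : 'I_m * 'I_n * 'I_4) : R := let z := X j i.1.1 i.1.2 in
  [:: q1 z; qi z; qj z; qk z]`_i.2.
have xC j i : `|x j i| <= C.
  case: i => -[a b] t; apply: le_trans (XC j).
  apply: le_trans (absq_le_mxfrob (X j) a b).
  have [? ? ? ?] := normr_le_absq (X j a b).
  by case: t => -[|[|[|[|]]]].
have [u u_incr [l xl]] := bolzano_weierstrass_finite (enum {: 'I_m * 'I_n * 'I_4}) xC.
exists u => //; pose o (t : nat) : 'I_4 := inord t.
exists (\matrix_(a, b) Quat (l (a, b, o 0%N)) (l (a, b, o 1%N)) (l (a, b, o 2%N))
  (l (a, b, o 3%N))).
apply/mxcvgP => a b; rewrite mxE.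
have xl' t : x (u j) (a, b, o t) @[j --> \oo] --> l (a, b, o t).
  by apply: xl; rewrite mem_enum.
split.
- by have := xl' 0%N; rewrite /x /= inordK.
- by have := xl' 1%N; rewrite /x /= inordK.
- by have := xl' 2%N; rewrite /x /= inordK.
- by have := xl' 3%N; rewrite /x /= inordK.
Qed.

End Matrices.

Lemma mxcvg_ctrmx m n (X : nat -> 'M[H]_(m, n)) L :
  mxcvg X L -> mxcvg (fun j => ctrmx (X j)) (ctrmx L).
Proof.
move=> /mxcvgP XL; apply/mxcvgP => a b.
by under eq_fun do rewrite !mxE; rewrite !mxE; exact: qcvg_conj.
Qed.

Lemma mxcvg_mulmx m n p (X : nat -> 'M[H]_(m, n)) L (Y : nat -> 'M[H]_(n, p)) L' :
  mxcvg X L -> mxcvg Y L' -> mxcvg (fun j => X j *m Y j) (L *m L').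
Proof.
move=> /mxcvgP XL /mxcvgP YL; apply/mxcvgP => a b.
under eq_fun do rewrite mxE; rewrite mxE; apply: qcvg_sum => i.
exact: qcvgM.
Qed.

(** The extreme value theorem without a topology on [T]: the hypothesis bundles sequential
    compactness of [S] with continuity of [f] along the extracted subsequence. It serves both pairs
    of unitary matrices and closed balls. *)
Lemma seq_compact_max (T : Type) (S : set T) (f : T -> R) : S !=set0 ->
  (forall x : nat -> T, (forall j, S (x j)) ->
    exists2 u : nat -> nat, {homo u : a b / (a < b)%N} &
      exists2 l, S l & f (x (u j)) @[j --> \oo] --> f l) ->
  exists2 x, S x & forall y, S y -> f y <= f x.
Proof.
move=> [s0 Ss0] S_compact.
have choose_seq (g : nat -> R) : (forall j, exists2 y, S y & g j < f y) ->
    exists2 x : nat -> T, forall j, S (x j) & forall j, g j < f (x j).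
  move=> gf; have /choice[x xP] : forall j, exists y, S y /\ g j < f y.
    by move=> j; have [y Sy gy] := gf j; exists y.
  by exists x => j; case: (xP j).
(* Otherwise some sequence in [S] has [f (x j) > j], against convergence of [f] along a
   subsequence. *)
have bnd : has_ubound (f @` S).
  apply: contrapT => nbnd.
  have [j|x Sx xgt] := choose_seq (fun j => j%:R).
    apply: contrapT => jn; apply: nbnd; exists j%:R => _ [y Sy <-].
    by rewrite leNgt; apply/negP => ?; apply: jn; exists y.
  have [u u_incr [l Sl fl]] := S_compact x Sx.
  have /cvgrPdist_lt/(_ 1 ltr01) := fl.
  (* Past [K] the values stay below [f l + 1], whereas from index [M.+1] on they exceed it. *)
  move=> [K _ /= KP]; pose M := Num.truncn (f l + 1).
  have := KP (maxn K M.+1); rewrite /= leq_maxl => /(_ isT).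
  rewrite distrC => /ltr_distlDr; apply/negP; rewrite -leNgt.
  apply: le_trans (ltW (xgt _)); apply: le_trans (ltW (truncnS_gt _)) _.
  by rewrite ler_nat (leq_trans (leq_maxr K _)) // subseq_ge.
have supS : has_sup (f @` S) by split => //; exists (f s0), s0.
have [j|x Sx xgt] := choose_seq (fun j => sup (f @` S) - j.+1%:R^-1).
  have /(sup_adherent) /(_ supS)[_ [y Sy <-] lty] : 0 < j.+1%:R^-1 :> R by [].
  by exists y.
have [u u_incr [l Sl fl]] := S_compact x Sx.
exists l => // y Sy; apply: (@le_trans _ _ (sup (f @` S))).
  by apply: ub_le_sup => //; exists y.
suff fsup : f (x (u j)) @[j --> \oo] --> sup (f @` S).
  by rewrite (cvg_real_unique fl fsup).
apply: (cvg_dist_le (e := harmonic)); last exact: cvg_harmonic.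
move=> j /=.
have fx : f (x (u j)) <= sup (f @` S) by apply: ub_le_sup => //; exists (x (u j)).
rewrite distrC ger0_norm ?subr_ge0 //.
apply: (@le_trans _ _ (u j).+1%:R^-1); first by rewrite lerBlDl -lerBlDr ltW.
by rewrite /= lef_pV2 ?posrE // ler_nat ltnS subseq_ge.
Qed.

End Sequences.

(** * Unitary matrices and maximisers of the real trace *)

Section Unitary.
Variable R : realType.
Local Notation H := (quat R).

Lemma absq_sum (T : Type) (r : seq T) (E : T -> H) :
  absq (\sum_(i <- r) E i) <= \sum_(i <- r) absq (E i).
Proof.
elim: r => [|i r IH]; first by rewrite !big_nil (_ : absq 0 = 0) //; apply/eqP; rewrite absq_eq0.
by rewrite !big_cons (le_trans (ler_absqD _ _)) // lerD2l.
Qed.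

Lemma ctrmxE m n (A : 'M[H]_(m, n)) i j : ctrmx A i j = conjq (A j i).
Proof. by rewrite !mxE. Qed.

Lemma ctrmxK m n (A : 'M[H]_(m, n)) : ctrmx (ctrmx A) = A.
Proof. by apply/matrixP => i j; rewrite !ctrmxE conjqK. Qed.

Lemma ctrmxM m n p (A : 'M[H]_(m, n)) (B : 'M[H]_(n, p)) :
  ctrmx (A *m B) = ctrmx B *m ctrmx A.
Proof.
apply/matrixP => i j; rewrite ctrmxE !mxE conjq_sum.
by apply: eq_bigr => k _; rewrite !ctrmxE conjqM.
Qed.

Lemma ctrmx1 n : ctrmx (1%:M : 'M[H]_n) = 1%:M.
Proof.
apply/matrixP => i j; rewrite ctrmxE !mxE eq_sym.
by case: (_ == _); rewrite ?conjq1 ?conjq0.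
Qed.

Lemma unitary1 n : is_unitary (1%:M : 'M[H]_n).
Proof. by rewrite /is_unitary ctrmx1 mulmx1. Qed.

Lemma unitary_ctrmx n (U : 'M[H]_n) : is_unitary U -> is_unitary (ctrmx U).
Proof. by move=> [? ?]; rewrite /is_unitary ctrmxK. Qed.

Lemma unitaryM n (U V : 'M[H]_n) :
  is_unitary U -> is_unitary V -> is_unitary (U *m V).
Proof.
move=> [UU' U'U] [VV' V'V]; rewrite /is_unitary ctrmxM; split.
  by rewrite mulmxA -(mulmxA U) VV' mulmx1.
by rewrite mulmxA -(mulmxA (ctrmx V)) U'U mulmx1.
Qed.

Lemma unitary_row n (U : 'M[H]_n) i : is_unitary U -> \sum_j sqnormq (U i j) = 1.
Proof.
move=> [/matrixP/(_ i i) + _]; rewrite !mxE eqxx => /(congr1 (@q1 R)).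
rewrite /= => UU1; rewrite -[RHS]UU1 q1_sum; apply: eq_bigr => j _.
by rewrite ctrmxE mulq_conj.
Qed.

Lemma unitary_col n (U : 'M[H]_n) j : is_unitary U -> \sum_i sqnormq (U i j) = 1.
Proof.
move=> /unitary_ctrmx/(unitary_row j) <-.
by apply: eq_bigr => i _; rewrite ctrmxE sqnormq_conj.
Qed.

Lemma unitary_mxfrob n (U : 'M[H]_n) : is_unitary U -> mxfrob U = Num.sqrt n%:R.
Proof.
move=> Uu; rewrite mxfrob_sqrtE (eq_bigr (fun=> 1)) => [|i _].
  by rewrite sumr_const card_ord.
exact: unitary_row.
Qed.

Lemma unitary_absq_le1 n (U : 'M[H]_n) i j : is_unitary U -> absq (U i j) <= 1.
Proof.
move=> /(unitary_row i) U1; rewrite -(@ler_pXn2r _ 2) ?nnegrE ?absq_ge0 //.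
rewrite sqr_absq expr1n -U1 (bigD1 j) //= lerDl.
by apply: sumr_ge0 => k _; exact: sqnormq_ge0.
Qed.

Lemma unitary_closed n (X : nat -> 'M[H]_n) L :
  (forall j, is_unitary (X j)) -> mxcvg X L -> is_unitary L.
Proof.
move=> Xu XL; have XL' := mxcvg_ctrmx XL; split.
- apply: mxcvg_unique (mxcvg_mulmx XL XL') _.
  by rewrite (_ : (fun j => _) = fun=> 1%:M); [exact: mxcvg_cst
    |apply/funext => j; case: (Xu j)].
- apply: mxcvg_unique (mxcvg_mulmx XL' XL) _.
  by rewrite (_ : (fun j => _) = fun=> 1%:M); [exact: mxcvg_cst
    |apply/funext => j; case: (Xu j)].
Qed.

Lemma unitary_compact n (X : nat -> 'M[H]_n) : (forall j, is_unitary (X j)) ->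
  exists2 u : nat -> nat, {homo u : a b / (a < b)%N} &
    exists2 L, is_unitary L & mxcvg (X \o u) L.
Proof.
move=> Xu.
have [j|u u_incr [L XL]] := @mx_bolzano_weierstrass _ _ _ X (Num.sqrt n%:R).
  by rewrite unitary_mxfrob.
exists u => //; exists L => //; apply: unitary_closed XL => j; exact: Xu.
Qed.

Definition retr n (M : 'M[H]_n) : R := \sum_i q1 (M i i).

(** The quaternionic trace is not cyclic, but its real part is, because the real part of a product
    of two quaternions ignores their order. *)
Lemma retr_mulC m n (A : 'M[H]_(m, n)) (B : 'M[H]_(n, m)) :
  retr (A *m B) = retr (B *m A).
Proof.
rewrite /retr; under eq_bigr do rewrite mxE q1_sum.
rewrite exchange_big; apply: eq_bigr => j _; rewrite mxE q1_sum.
by apply: eq_bigr => i _; rewrite q1_mulC.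
Qed.

Lemma retrD n (A B : 'M[H]_n) : retr (A + B) = retr A + retr B.
Proof. by rewrite /retr -big_split; apply: eq_bigr => i _; rewrite mxE. Qed.

Lemma cvg_retr n (X : nat -> 'M[H]_n) L :
  mxcvg X L -> retr (X j) @[j --> \oo] --> retr L.
Proof.
by move=> /mxcvgP XL; apply: cvg_sum_real => i; case: (XL i i).
Qed.

(** A quaternionic Givens rotation. Since the diagonal entry [x] is real, taking the adjoint only
    changes the sign of [y]. *)
Definition rot_mx n (i j : 'I_n) (x : R) (y : H) : 'M[H]_n := \matrix_(a, b)
  if a == i then (if b == i then realq x else if b == j then y else 0)
  else if a == j then (if b == i then - conjq y else if b == j then realq x else 0)
  else (a == b)%:R.

Lemma rot_mulmx m n (i j : 'I_m) x y (B : 'M[H]_(m, n)) a b : i != j ->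
  (rot_mx i j x y *m B) a b =
  if a == i then realq x * B i b + y * B j b
  else if a == j then - conjq y * B i b + realq x * B j b
  else B a b.
Proof.
move=> ij; have ji : j != i by rewrite eq_sym.
have sum2 (u v : H) : \sum_k (if k == i then u else if k == j then v else 0) * B k b =
    u * B i b + v * B j b.
  rewrite (bigD1 i) //= (bigD1 j) //= !eqxx (negPf ji) big1 ?addr0 // => k.
  by move=> /andP[/negPf -> /negPf ->]; rewrite mul0r.
rewrite mxE; under eq_bigr do rewrite mxE.
case: ifP => _; first exact: sum2.
case: ifP => _; first exact: sum2.
rewrite (bigD1 a) //= eqxx mul1r big1 ?addr0 // => k /negPf ka.
by rewrite eq_sym ka mul0r.
Qed.

Lemma ctrmx_rot n (i j : 'I_n) x y : i != j ->
  ctrmx (rot_mx i j x y) = rot_mx i j x (- y).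
Proof.
move=> ij; apply/matrixP => a b; rewrite ctrmxE !mxE.
have [ai|ai] := eqVneq a i; have [bi|bi] := eqVneq b i;
  have [aj|aj] := eqVneq a j; have [bj|bj] := eqVneq b j;
  rewrite ?conjqN ?conjqK ?conjq_real ?conjq0 ?opprK //;
  try by [move: ij; rewrite -ai aj eqxx | move: ij; rewrite -bi bj eqxx].
- by rewrite ai (negPf bi) conjq0.
- by rewrite bi (negPf ai).
- by rewrite aj (negPf bj) conjq0.
- by rewrite bj (negPf aj).
- by rewrite eq_sym; case: (a == b); rewrite ?conjq1 ?conjq0.
Qed.

Lemma unitary_rot n (i j : 'I_n) x y : i != j -> x ^+ 2 + sqnormq y = 1 ->
  is_unitary (rot_mx i j x y).
Proof.
move=> ij.
have rot_ctrmx y' : x ^+ 2 + sqnormq y' = 1 ->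
    rot_mx i j x y' *m rot_mx i j x (- y') = 1%:M.
  move=> xy1; have ji : j != i by rewrite eq_sym.
  apply/matrixP => a b; rewrite rot_mulmx // !mxE !eqxx (negPf ji).
  have [ai|ai] := eqVneq a i; have [bi|bi] := eqVneq b i;
    have [aj|aj] := eqVneq a j; have [bj|bj] := eqVneq b j;
    rewrite ?mulr0 ?addr0 //;
    try by [move: ij; rewrite -ai aj eqxx | move: ij; rewrite -bi bj eqxx].
  - by rewrite ai bi eqxx conjqN opprK mulq_conj realqM -realqD -expr2 xy1.
  - by rewrite ai bj (negPf ij) realqC mulNr addNr.
  - by rewrite ai eq_sym (negPf bi).
  - by rewrite aj bi (negPf ji) conjqN opprK realqC mulNr addNr.
  - by rewrite aj bj eqxx mulrNN mulconjq realqM -realqD addrC -expr2 xy1.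
  - by rewrite aj eq_sym (negPf bj).
move=> xy1; rewrite /is_unitary ctrmx_rot //; split; first exact: rot_ctrmx.
by rewrite -{2}[y]opprK; apply: rot_ctrmx; rewrite sqnormqN.
Qed.

Lemma unitary_phase n (i : 'I_n) (z : H) : sqnormq z = 1 ->
  is_unitary (diag_mx (\row_a if a == i then z else 1)).
Proof.
move=> z1.
have ctr : ctrmx (diag_mx (\row_a if a == i then z else 1)) =
    diag_mx (\row_a if a == i then conjq z else 1).
  apply/matrixP => a b; rewrite ctrmxE !mxE !mulrb.
  have [->|_] := eqVneq a b; last by rewrite conjq0.
  by case: ifP => _; rewrite ?conjq1.
by split; rewrite ctr mulmx_diag; apply/matrixP => a b; rewrite !mxE;
  case: ifP => _; rewrite ?mulr1 ?mulq_conj ?mulconjq ?z1.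
Qed.

(* A maximiser of [Re tr (G M)] over the unitary [G] is a critical point along
   plane rotations and diagonal phases: this makes [M] Hermitian with a
   nonnegative diagonal. *)
Lemma retr_max_hermitian n (M : 'M[H]_n) :
  (forall G, is_unitary G -> retr (G *m M) <= retr M) ->
  (forall i j, M i j = conjq (M j i)) /\ (forall i, 0 <= q1 (M i i)).
Proof.
move=> Mmax.
(* Multiplying row [i] by the phase [z] that turns [M i i] into its modulus cannot increase the real
   trace. *)
have diag i : absq (M i i) <= q1 (M i i).
  have [->|Mii_neq0] := eqVneq (M i i) 0.
    by rewrite (_ : absq 0 = 0) //; apply/eqP; rewrite absq_eq0.
  have r0 : absq (M i i) != 0 by rewrite absq_eq0.
  pose z := realq (absq (M i i))^-1 * conjq (M i i).
  have z1 : sqnormq z = 1.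
    rewrite sqnormqM sqnormq_real sqnormq_conj -sqr_absq.
    by rewrite -exprMn mulVf // expr1n.
  have := Mmax _ (unitary_phase i z1).
  rewrite mul_diag_mx /retr (bigD1 i) //= [leRHS](bigD1 i) //= !mxE eqxx.
  rewrite (eq_bigr (fun a => q1 (M a a))) => [|a /negPf ai].
    rewrite lerD2r; apply: le_trans.
    by rewrite /z -mulrA mulconjq realqM -sqr_absq expr2 mulrA mulVf // mul1r.
  by rewrite !mxE ai mul1r.
split=> [i j|i]; last exact: le_trans (absq_ge0 _) (diag i).
have [->|ij] := eqVneq i j.
  have := diag j; rewrite -(@ler_pXn2r _ 2) ?nnegrE ?absq_ge0 //; last first.
    exact: le_trans (absq_ge0 _) (diag j).
  rewrite sqr_absq /sqnormq => Mjj.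
  have := (sqr_ge0 (qi (M j j)), sqr_ge0 (qj (M j j)), sqr_ge0 (qk (M j j))).
  move=> [[ni nj] nk].
  have zi : qi (M j j) = 0 by apply/eqP; rewrite -sqrf_eq0 eq_le ni andbT; lra.
  have zj : qj (M j j) = 0 by apply/eqP; rewrite -sqrf_eq0 eq_le nj andbT; lra.
  have zk : qk (M j j) = 0 by apply/eqP; rewrite -sqrf_eq0 eq_le nk andbT; lra.
  by apply: quat_eq; rewrite //= ?zi ?zj ?zk oppr0.
(* [d] measures the failure of symmetry. The rotation with [x = al / r] and [y = conjq d / r]
   changes the contribution [al] of the two diagonal entries into [r], where
   [r ^+ 2 = al ^+ 2 + sqnormq d]; maximality gives [r <= al], which forces [d = 0]. *)
pose d := M j i - conjq (M i j); pose al := q1 (M i i) + q1 (M j j).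
suff d0 : d = 0.
  by apply/esym; rewrite -[RHS]conjqK; congr conjq; apply/eqP; rewrite -subr_eq0 -/d d0.
apply/eqP; apply: contraT => d_neq0.
have d_gt0 : 0 < sqnormq d by rewrite lt_neqAle sqnormq_ge0 andbT eq_sym sqnormq_eq0.
pose r := Num.sqrt (al ^+ 2 + sqnormq d).
have r2 : r ^+ 2 = al ^+ 2 + sqnormq d.
  by rewrite sqr_sqrtr // addr_ge0 ?sqr_ge0 ?sqnormq_ge0.
have r_gt0 : 0 < r by rewrite sqrtr_gt0 ltr_wpDl ?sqr_ge0.
pose y := realq r^-1 * conjq d.
have xy1 : (al / r) ^+ 2 + sqnormq y = 1.
  rewrite sqnormqM sqnormq_real sqnormq_conj exprMn (mulrC (al ^+ 2)) -mulrDr -r2.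
  by rewrite -exprMn mulVf ?expr1n // gt_eqF.
have := Mmax _ (unitary_rot ij xy1).
have ji : j != i by rewrite eq_sym.
rewrite /retr (bigD1 i) //= [leRHS](bigD1 i) //= (bigD1 j) //= [X in _ <= _ + X](bigD1 j) //=.
rewrite !rot_mulmx // !eqxx (negPf ji).
rewrite (eq_bigr (fun a => q1 (M a a))) => [|a /andP[/negPf ai /negPf aj]]; last first.
  by rewrite rot_mulmx // ai aj.
rewrite !addrA lerD2r -/al => le_al.
suff : r <= al.
  move=> r_al; have : r ^+ 2 <= al ^+ 2.
    have r_ge0 := ltW r_gt0.
    by rewrite lerXn2r ?nnegrE // (le_trans r_ge0).
  by rewrite r2; lra.
apply: le_trans le_al; rewrite le_eqVlt; apply/orP; left; apply/eqP.
have r_neq0 : r != 0 by rewrite gt_eqF.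
transitivity (r^-1 * (al ^+ 2 + sqnormq d)).
  by rewrite -r2 expr2 mulrA mulVf // mul1r.
by rewrite /y /al /sqnormq /d /=; ring.
Qed.

End Unitary.

(** * Existence and Lipschitz continuity of the singular values *)

Section SingularValues.
Variable R : realType.
Local Notation H := (quat R).

(** Eliminating [y] leaves [(a - b) * (a + b) * x = 0]. This kills the off-diagonal entries of a
    maximiser, with two distinct entries of the weight as [a] and [b]. *)
Lemma realq_cross_eq0 (a b : R) (x y : H) : 0 < a -> 0 < b -> a != b ->
  realq a * x = realq b * y -> realq b * x = realq a * y -> x = 0.
Proof.
move=> a0 b0 ab.
have cross (t v : R) : a * t = b * v -> b * t = a * v -> t = 0.
  move=> e1 e2; have : (a - b) * (a + b) * t = 0.
    rewrite (_ : _ * t = a * (a * t) - b * (b * t)); last by ring.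
    by rewrite e1 e2; ring.
  move/eqP; rewrite !mulf_eq0 subr_eq0 (negPf ab) (gt_eqF (addr_gt0 a0 b0)) /=.
  by move/eqP.
move=> e1 e2; apply: quat_eq; apply: cross.
- by have := congr1 (@q1 R) e1; rewrite /= !mul0r !subr0; exact.
- by have := congr1 (@q1 R) e2; rewrite /= !mul0r !subr0; exact.
- by have := congr1 (@qi R) e1; rewrite /= !mul0r !subr0 !addr0; exact.
- by have := congr1 (@qi R) e2; rewrite /= !mul0r !subr0 !addr0; exact.
- by have := congr1 (@qj R) e1; rewrite /= !mul0r !subr0 !addr0; exact.
- by have := congr1 (@qj R) e2; rewrite /= !mul0r !subr0 !addr0; exact.
- by have := congr1 (@qk R) e1; rewrite /= !mul0r !subr0 !addr0; exact.
- by have := congr1 (@qk R) e2; rewrite /= !mul0r !subr0 !addr0; exact.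
Qed.

Lemma unitary_tperm n (i j : 'I_n) : is_unitary (tperm_mx i j : 'M[H]_n).
Proof.
have ctr : ctrmx (tperm_mx i j : 'M[H]_n) = tperm_mx i j.
  rewrite /ctrmx tr_tperm_mx; apply/matrixP => a b; rewrite !mxE.
  by case: (_ == _); rewrite ?conjq1 ?conjq0.
by rewrite /is_unitary ctr -perm_mxM tperm2 perm_mx1.
Qed.

Section RealDiagonal.
Variables m n : nat.
Local Notation dl := (widen_ord (geq_minl m n)).
Local Notation dr := (widen_ord (geq_minr m n)).

Lemma widen_ordl_inj : injective dl.
Proof. by move=> l l' /(congr1 val)/= ?; exact: val_inj. Qed.

Lemma widen_ordr_inj : injective dr.
Proof. by move=> l l' /(congr1 val)/= ?; exact: val_inj. Qed.

Lemma mulmx_rdiag p (W : 'M[H]_(p, m)) (s : 'rV[R]_(minn m n)) a j :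
  (W *m rdiagmx s) a j = \sum_(l < minn m n | l == j :> nat) W a (dl l) * realq (s 0 l).
Proof.
rewrite mxE; under eq_bigr do rewrite mxE big_distrr /=.
rewrite (exchange_big_dep (fun l : 'I__ => l == j :> nat)) /=; last first.
  by move=> i l _ /andP[].
apply: eq_bigr => l lj; rewrite (big_pred1 (dl l)) // => i.
by rewrite lj andbT /= -val_eqE /= eq_sym.
Qed.

Lemma mulmx_rdiag_ctr p (B : 'M[H]_(p, n)) (c : 'rV[R]_(minn m n)) a i :
  (B *m ctrmx (rdiagmx c)) a i = \sum_(l < minn m n | l == i :> nat) B a (dr l) * realq (c 0 l).
Proof.
rewrite mxE; under eq_bigr do rewrite ctrmxE mxE conjq_sum big_distrr /=.
rewrite (exchange_big_dep (fun l : 'I__ => l == i :> nat)) /=; last first.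
  by move=> j l _ /andP[].
apply: eq_bigr => l li; rewrite (big_pred1 (dr l)) ?conjq_real // => j.
by rewrite li /= -val_eqE /= eq_sym.
Qed.

Lemma ctr_rdiag_mulmx p (B : 'M[H]_(m, p)) (c : 'rV[R]_(minn m n)) j b :
  (ctrmx (rdiagmx c) *m B) j b = \sum_(l < minn m n | l == j :> nat) realq (c 0 l) * B (dl l) b.
Proof.
rewrite -[LHS]conjqK -ctrmxE ctrmxM ctrmxK mulmx_rdiag conjq_sum.
by apply: eq_bigr => l _; rewrite conjqM conjq_real ctrmxE conjqK.
Qed.

Lemma rdiag_sandwich p q (W : 'M[H]_(p, m)) (s : 'rV[R]_(minn m n))
    (Z : 'M[H]_(q, n)) a b :
  (W *m rdiagmx s *m ctrmx Z) a b =
  \sum_l realq (s 0 l) * (W a (dl l) * conjq (Z b (dr l))).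
Proof.
rewrite mxE; under eq_bigr do rewrite mulmx_rdiag ctrmxE big_distrl /=.
rewrite (exchange_big_dep xpredT) //=; apply: eq_bigr => l _.
rewrite (big_pred1 (dr l)) => [|j]; last by rewrite /= -val_eqE /= eq_sym.
by rewrite -realqC mulrA.
Qed.

Lemma retr_rdiag_ctr (B : 'M[H]_(m, n)) (c : 'rV[R]_(minn m n)) :
  retr (B *m ctrmx (rdiagmx c)) = \sum_l c 0 l * q1 (B (dl l) (dr l)).
Proof.
rewrite /retr; under eq_bigr do rewrite mulmx_rdiag_ctr q1_sum.
rewrite (exchange_big_dep xpredT) //=; apply: eq_bigr => l _.
rewrite (big_pred1 (dl l)) => [|i]; last by rewrite /= -val_eqE /= eq_sym.
by rewrite /=; ring.
Qed.

Lemma rdiag_diag (s : 'rV[R]_(minn m n)) l : rdiagmx s (dl l) (dr l) = realq (s 0 l).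
Proof.
by rewrite mxE (big_pred1 l) // => k; rewrite /= andbb /= -val_eqE.
Qed.

Lemma rdiag_offdiag (s : 'rV[R]_(minn m n)) (i : 'I_m) (j : 'I_n) :
  i != j :> nat -> rdiagmx s i j = 0.
Proof.
move=> ij; rewrite mxE big_pred0 // => l.
by apply/negP => /andP[/eqP li /eqP lj]; rewrite -li lj eqxx in ij.
Qed.

(* Maximising [Re tr (U^H A V D^H)] over unitary [U] and [V], for a diagonal [D]
   with positive strictly decreasing entries, turns [U^H A V] into the diagonal
   matrix of the singular values. *)
Lemma retr_max_rdiag (B : 'M[H]_(m, n)) (c : 'rV[R]_(minn m n)) :
  (forall l, 0 < c 0 l) ->
  (forall l l' : 'I_(minn m n), (l < l')%N -> c 0 l' < c 0 l) ->
  (forall G K, is_unitary G -> is_unitary K ->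
    retr (G *m B *m K *m ctrmx (rdiagmx c)) <= retr (B *m ctrmx (rdiagmx c))) ->
  exists s : 'rV[R]_(minn m n), [/\ forall l, 0 <= s 0 l,
    forall l l' : 'I_(minn m n), (l <= l')%N -> s 0 l' <= s 0 l & B = rdiagmx s].
Proof.
move=> c_gt0 c_decr Bmax.
have [G Gu|Lherm Lpos] := retr_max_hermitian (M := B *m ctrmx (rdiagmx c)).
  by have := Bmax _ _ Gu (unitary1 _ _); rewrite mulmx1 mulmxA.
have [K Ku|Rherm _] := retr_max_hermitian (M := ctrmx (rdiagmx c) *m B).
  rewrite retr_mulC -mulmxA retr_mulC [leRHS]retr_mulC.
  by have := Bmax _ _ (unitary1 _ _) Ku; rewrite mul1mx.
have LE a l : (B *m ctrmx (rdiagmx c)) a (dl l) = B a (dr l) * realq (c 0 l).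
  by rewrite mulmx_rdiag_ctr (big_pred1 l) // => k; rewrite /= -val_eqE.
have RE l b : (ctrmx (rdiagmx c) *m B) (dr l) b = realq (c 0 l) * B (dl l) b.
  by rewrite ctr_rdiag_mulmx (big_pred1 l) // => k; rewrite /= -val_eqE.
have scale0 l z : realq (c 0 l) * z = 0 -> z = 0.
  move=> cz; have : realq (c 0 l)^-1 * (realq (c 0 l) * z) = 0 by rewrite cz mulr0.
  by rewrite mulrA realqM mulVf ?gt_eqF // mul1r.
have diagE l : B (dl l) (dr l) = realq (q1 (B (dl l) (dr l))).
  have := Lherm (dl l) (dl l); rewrite LE -realqC conjqM conjq_real -realqC => e.
  have : realq (c 0 l) * (B (dl l) (dr l) - conjq (B (dl l) (dr l))) = 0.
    by rewrite mulrBr -e subrr.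
  move/scale0/eqP; rewrite subr_eq0 => /eqP; case: (B _ _) => a b d f [] eb ed ef.
  by apply: quat_eq => //=; lra.
have diag_ge0 l : 0 <= q1 (B (dl l) (dr l)).
  by have := Lpos (dl l); rewrite LE -realqC /= !mul0r !subr0 pmulr_rge0.
have offdiag (i : 'I_m) (j : 'I_n) : i != j :> nat -> B i j = 0.
  (* At most one of the two indices reaches [minn m n]; if one does, the Hermitian partner of the
     weighted entry is an empty sum. *)
  move=> ij; have [li|ge_i] := ltnP i (minn m n); last first.
    have [lj|ge_j] := ltnP j (minn m n); last first.
      have := leq_ltn_trans ge_j (ltn_ord j); have := leq_ltn_trans ge_i (ltn_ord i).
      by rewrite !gtn_min !ltnn orbF /= => /ltn_trans lt /lt; rewrite ltnn.
    have -> : j = dr (Ordinal lj) by exact: val_inj.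
    apply: (scale0 (Ordinal lj)); rewrite realqC -LE Lherm mulmx_rdiag_ctr big_pred0 ?conjq0 //.
    by move=> l /=; apply/negbTE; rewrite neq_ltn (leq_trans _ ge_i).
  have ei : i = dl (Ordinal li) by exact: val_inj.
  have [lj|ge_j] := ltnP j (minn m n); last first.
    rewrite ei; apply: (scale0 (Ordinal li)); rewrite -RE Rherm ctr_rdiag_mulmx.
    rewrite big_pred0 ?conjq0 // => l /=; apply/negbTE.
    by rewrite neq_ltn (leq_trans _ ge_j).
  have ej : j = dr (Ordinal lj) by exact: val_inj.
  rewrite ei ej; set l := Ordinal li; set l' := Ordinal lj.
  (* The two Hermitian conditions both relate the entry to the conjugate of its mirror image, with
     the weights [c 0 l] and [c 0 l'] exchanged. *)
  apply: (realq_cross_eq0 (c_gt0 l') (c_gt0 l) (y := conjq (B (dl l') (dr l)))).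
  - by move: ij; rewrite neq_ltn => /orP[ij|ij];
      [rewrite lt_eqF|rewrite gt_eqF] => //; exact: c_decr.
  - by rewrite realqC -LE Lherm LE conjqM conjq_real.
  - by rewrite -RE Rherm RE conjqM conjq_real realqC.
exists (\row_l q1 (B (dl l) (dr l))); split.
- by move=> l; rewrite mxE.
- move=> l l'; rewrite leq_eqVlt => /orP[/eqP/val_inj -> //|ll'].
  (* Exchanging positions [l] and [l'] on both sides gives a competitor; as [c] decreases strictly,
     the diagonal of [B] must follow the same order. *)
  have := Bmax _ _ (unitary_tperm (dl l) (dl l')) (unitary_tperm (dr l) (dr l')).
  rewrite -xrowE -xcolE !retr_rdiag_ctr.
  under eq_bigr do rewrite !mxE -(inj_tperm _ _ _ widen_ordl_inj) -(inj_tperm _ _ _ widen_ordr_inj).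
  have l'l : l' != l by rewrite -val_eqE gt_eqF.
  rewrite (bigD1 l) //= (bigD1 l') //= [leRHS](bigD1 l) //= [X in _ <= _ + X](bigD1 l') //=.
  rewrite tpermL tpermR [X in _ + (_ + X)](eq_bigr (fun p => c 0 p * q1 (B (dl p) (dr p)))).
    rewrite !addrA lerD2r !mxE => swap_le; have := c_decr _ _ ll'.
    rewrite -subr_gt0 => /ler_pM2l <-; nra.
  by move=> p /andP[pl pl']; rewrite tpermD // eq_sym.
- apply/matrixP => i j; have [ij|ij] := eqVneq (i : nat) (j : nat); last first.
    by rewrite offdiag // rdiag_offdiag.
  have li : (i < minn m n)%N by rewrite leq_min ltn_ord ij ltn_ord.
  have -> : i = dl (Ordinal li) by exact: val_inj.
  have -> : j = dr (Ordinal li) by apply: val_inj; rewrite /= ij.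
  by rewrite rdiag_diag mxE.
Qed.

Lemma singular_values_exist (A : 'M[H]_(m, n)) : exists s, is_singular_values A s.
Proof.
(* Any positive strictly decreasing weight would do; this one ends at [1]. *)
pose c : 'rV[R]_(minn m n) := \row_l (minn m n - l)%:R.
pose S : set ('M[H]_m * 'M[H]_n) := [set UV | is_unitary UV.1 /\ is_unitary UV.2].
pose f (UV : 'M[H]_m * 'M[H]_n) :=
  retr (ctrmx UV.1 *m A *m UV.2 *m ctrmx (rdiagmx c)).
have [||[U V] [/= Uu Vu] UVmax] := @seq_compact_max R _ S f.
- by exists (1%:M, 1%:M); split; exact: unitary1.
- move=> x Sx.
  have [j|u u_incr [U Uu xU]] := @unitary_compact R _ (fun j => (x j).1).
    by case: (Sx j).
  have [j|v v_incr [V Vu xV]] := @unitary_compact R _ (fun j => (x (u j)).2).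
    by case: (Sx (u j)).
  exists (u \o v) => [a b ab|]; first exact/u_incr/v_incr.
  exists (U, V) => //; apply: cvg_retr.
  apply: mxcvg_mulmx (mxcvg_cst _); apply: mxcvg_mulmx xV.
  apply: mxcvg_mulmx (mxcvg_cst _); apply: mxcvg_ctrmx.
  exact: (mxcvg_subseq v_incr xU).
have [UU' U'U] := Uu; have [VV' V'V] := Vu.
have [l|l l' ll'|G K Gu Ku|s [s_ge0 s_decr Bs]] :=
    @retr_max_rdiag (ctrmx U *m A *m V) c.
- by rewrite mxE ltr0n subn_gt0.
- by rewrite !mxE ltr_nat ltn_sub2l.
- have := UVmax (U *m ctrmx G, V *m K).
  rewrite /f /= ctrmxM ctrmxK !mulmxA; apply.
  by split; apply: unitaryM => //; exact: unitary_ctrmx.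
exists s; split => //; exists U, V; split => //.
by rewrite -Bs !mulmxA UU' mul1mx -mulmxA VV' mulmx1.
Qed.

Lemma sum_widen_ordl (E : 'I_m -> R) :
  (forall i, 0 <= E i) -> \sum_l E (dl l) <= \sum_i E i.
Proof.
move=> E_ge0; rewrite [leRHS](bigID (fun i => i \in dl @: 'I_(minn m n))) /=.
rewrite big_imset /=; last by move=> ? ? _ _; exact: widen_ordl_inj.
rewrite [X in _ <= X + _](eq_bigl xpredT) => [|l]; last by rewrite inE.
by rewrite lerDl sumr_ge0.
Qed.

Lemma sum_widen_ordr (E : 'I_n -> R) :
  (forall i, 0 <= E i) -> \sum_l E (dr l) <= \sum_i E i.
Proof.
move=> E_ge0; rewrite [leRHS](bigID (fun i => i \in dr @: 'I_(minn m n))) /=.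
rewrite big_imset /=; last by move=> ? ? _ _; exact: widen_ordr_inj.
rewrite [X in _ <= X + _](eq_bigl xpredT) => [|l]; last by rewrite inE.
by rewrite lerDl sumr_ge0.
Qed.

Definition head_indicator (k : nat) : 'rV[R]_(minn m n) := \row_l (l < k)%:R.

(** The bathtub principle: a threshold [th] separates the entries before [k] from the others, so
    every term [(s 0 l - th) * (t l - head_indicator k 0 l)] is nonpositive; as [th >= 0], the bound
    on the total of [t] then yields the claim. *)
Lemma weighted_sum_le_head (s : 'rV[R]_(minn m n)) (t : 'I_(minn m n) -> R) k :
  (forall l, 0 <= s 0 l) ->
  (forall l l' : 'I_(minn m n), (l <= l')%N -> s 0 l' <= s 0 l) ->
  (forall l, 0 <= t l <= 1) -> \sum_l t l <= \sum_l head_indicator k 0 l ->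
  \sum_l s 0 l * t l <= \sum_l s 0 l * head_indicator k 0 l.
Proof.
move=> s_ge0 s_decr t01 t_sum.
have [th th_ge0 [th_lt th_ge]] : exists2 th : R, 0 <= th &
    (forall l : 'I_(minn m n), (l < k)%N -> th <= s 0 l) /\
    (forall l : 'I_(minn m n), (k <= l)%N -> s 0 l <= th).
  (* The threshold is the entry of [s] at [k], or [0] when the head covers all entries. *)
  have [k_lt|k_ge] := ltnP k (minn m n).
    by exists (s 0 (Ordinal k_lt)); [|split=> l lk; apply: s_decr => //; exact: ltnW].
  by exists 0; [|split=> l lk //; have := leq_trans k_ge lk; rewrite leqNgt ltn_ord].
have : \sum_l (s 0 l - th) * (t l - head_indicator k 0 l) <= 0.
  apply: sumr_le0 => l _; rewrite mxE; have /andP[t0 t1] := t01 l.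
  have [lk|lk] := ltnP l k.
    by rewrite mulr_ge0_le0 ?subr_ge0 ?th_lt // subr_le0.
  by rewrite mulr_le0_ge0 ?subr_le0 ?th_ge // subr0.
have -> : \sum_l (s 0 l - th) * (t l - head_indicator k 0 l) =
    \sum_l s 0 l * t l - \sum_l s 0 l * head_indicator k 0 l
    - th * (\sum_l t l - \sum_l head_indicator k 0 l).
  rewrite mulrBr !mulr_sumr -!sumrB; apply: eq_bigr => l _; ring.
have : th * (\sum_l t l - \sum_l head_indicator k 0 l) <= 0.
  by rewrite mulr_ge0_le0 // subr_le0.
lra.
Qed.

(* Ky Fan's maximum principle: the supremum over unitary [W], [Z] is attained at
   [W = 1], [Z = 1]. *)
Lemma ky_fan (s : 'rV[R]_(minn m n)) (W : 'M[H]_m) (Z : 'M[H]_n) k :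
  (forall l, 0 <= s 0 l) ->
  (forall l l' : 'I_(minn m n), (l <= l')%N -> s 0 l' <= s 0 l) ->
  is_unitary W -> is_unitary Z ->
  retr (W *m rdiagmx s *m ctrmx Z *m ctrmx (rdiagmx (head_indicator k))) <=
  \sum_l s 0 l * head_indicator k 0 l.
Proof.
move=> s_ge0 s_decr Wu Zu; set e := head_indicator k.
have e01 l : 0 <= e 0 l <= 1 by rewrite mxE; case: (_ < _)%N; rewrite ler01 lexx.
(* These weights come from [2 Re (w conj z) <= |w|^2 + |z|^2]. The columns of [W] and [Z] have norm
   one, so [t p <= 1]; the rows have norm one, so the total of [t] is at most that of [e]. *)
pose t p := \sum_l e 0 l *
  ((sqnormq (W (dl l) (dl p)) + sqnormq (Z (dr l) (dr p))) / 2).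
have half_le1 (a b : R) : a <= 1 -> b <= 1 -> (a + b) / 2 <= 1 by lra.
have half_ge0 x y : 0 <= (sqnormq x + sqnormq y : R) / 2.
  by rewrite divr_ge0 // addr_ge0 ?sqnormq_ge0.
apply: (@le_trans _ _ (\sum_p s 0 p * t p)); last first.
  apply: weighted_sum_le_head => // [p|].
    apply/andP; split.
      by apply: sumr_ge0 => l _; rewrite mulr_ge0 //; case/andP: (e01 l).
    apply: (@le_trans _ _ (\sum_l (sqnormq (W (dl l) (dl p)) +
        sqnormq (Z (dr l) (dr p))) / 2)).
      by apply: ler_sum => l _; rewrite ler_piMl //; case/andP: (e01 l).
    rewrite -mulr_suml big_split /=; apply: half_le1.
      rewrite -(unitary_col (dl p) Wu).
      by apply: (sum_widen_ordl (E := fun i => sqnormq (W i _))) => i; exact: sqnormq_ge0.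
    rewrite -(unitary_col (dr p) Zu).
    by apply: (sum_widen_ordr (E := fun i => sqnormq (Z i _))) => i; exact: sqnormq_ge0.
  rewrite exchange_big /=; apply: ler_sum => l _.
  rewrite -mulr_sumr ler_piMr //; first by case/andP: (e01 l).
  rewrite -mulr_suml big_split /=; apply: half_le1.
    rewrite -(unitary_row (dl l) Wu).
    by apply: (sum_widen_ordl (E := fun i => sqnormq (W _ i))) => i; exact: sqnormq_ge0.
  rewrite -(unitary_row (dr l) Zu).
  by apply: (sum_widen_ordr (E := fun i => sqnormq (Z _ i))) => i; exact: sqnormq_ge0.
rewrite retr_rdiag_ctr.
under [leRHS]eq_bigr do rewrite mulr_sumr.
rewrite exchange_big /=; apply: ler_sum => l _.
rewrite rdiag_sandwich q1_sum mulr_sumr; apply: ler_sum => p _.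
rewrite [leRHS]mulrCA; apply: ler_wpM2l; first by case/andP: (e01 l).
rewrite (_ : q1 _ = s 0 p * q1 (W (dl l) (dl p) * conjq (Z (dr l) (dr p)))); last first.
  by rewrite /=; ring.
apply: ler_wpM2l => //; set w := W _ _; set z := Z _ _.
have := sqnormq_ge0 (w - z).
rewrite (_ : sqnormq (w - z) = sqnormq w + sqnormq z - 2 * q1 (w * conjq z)); first lra.
by rewrite /sqnormq /=; ring.
Qed.

(** A crude bound: entries of unitary matrices have modulus at most one, and the constant counts the
    terms. *)
Lemma retr_unitary_le (U : 'M[H]_m) (V : 'M[H]_n) (E : 'M[H]_(m, n)) k :
  is_unitary U -> is_unitary V ->
  retr (ctrmx U *m E *m V *m ctrmx (rdiagmx (head_indicator k))) <=
  (minn m n * (n * m))%:R * mxfrob E.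
Proof.
move=> Uu Vu; rewrite retr_rdiag_ctr natrM -mulrA mulr_natl.
rewrite -[X in _ *+ X]card_ord -sumr_const; apply: ler_sum => l _.
have bnd : 0 <= (n * m)%:R * mxfrob E by rewrite mulr_ge0 ?mxfrob_ge0.
suff q1_le : q1 ((ctrmx U *m E *m V) (dl l) (dr l)) <= (n * m)%:R * mxfrob E.
  by rewrite mxE; case: (_ < _)%N; rewrite ?mul1r ?mul0r.
apply: le_trans (q1_le_absq _) _; rewrite mxE.
apply: le_trans (absq_sum _ _) _; rewrite natrM -mulrA mulr_natl.
rewrite -[X in _ *+ X]card_ord -sumr_const; apply: ler_sum => b _.
rewrite absqM; apply: le_trans (ler_piMr (absq_ge0 _) (unitary_absq_le1 _ _ Vu)) _.
rewrite mxE; apply: le_trans (absq_sum _ _) _; rewrite mulr_natl.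
rewrite -[X in _ *+ X]card_ord -sumr_const; apply: ler_sum => a _.
rewrite absqM ctrmxE absq_conj; apply: le_trans (absq_le_mxfrob _ a b).
by rewrite ler_piMl ?absq_ge0 // unitary_absq_le1.
Qed.

(** The unitary factors of [B] attain its Ky Fan sum. In the splitting [B = (B - A) + A],
    [retr_unitary_le] bounds the first part and [ky_fan] the second. *)
Lemma head_sum_le (A B : 'M[H]_(m, n)) s s' k :
  is_singular_values A s -> is_singular_values B s' ->
  \sum_l s' 0 l * head_indicator k 0 l <= \sum_l s 0 l * head_indicator k 0 l +
    (minn m n * (n * m))%:R * mxfrob (A - B).
Proof.
move=> [s_ge0 s_decr [U [V [Uu Vu AE]]]] [_ _ [U' [V' [Uu' Vu' BE]]]].
have -> : \sum_l s' 0 l * head_indicator k 0 l =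
    retr (ctrmx U' *m B *m V' *m ctrmx (rdiagmx (head_indicator k))).
  have [_ U'U'] := Uu'; have [_ V'V'] := Vu'.
  rewrite BE !mulmxA U'U' mul1mx -(mulmxA (rdiagmx s')) V'V' mulmx1 retr_rdiag_ctr.
  by apply: eq_bigr => l _; rewrite rdiag_diag mulrC.
rewrite -{1}(subrK A B) mulmxDr !mulmxDl retrD addrC; apply: lerD.
  rewrite {1}AE !mulmxA.
  rewrite (_ : _ *m ctrmx V *m V' = ctrmx U' *m U *m rdiagmx s *m ctrmx (ctrmx V' *m V)).
    by apply: ky_fan => //; apply: unitaryM => //; exact: unitary_ctrmx.
  by rewrite ctrmxM ctrmxK !mulmxA.
by rewrite mxfrobB; exact: retr_unitary_le.
Qed.

Definition weyl_const : R := 2 * (minn m n * (n * m))%:R.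

(** A singular value is the difference of two consecutive Ky Fan sums, whence the factor [2] in
    [weyl_const]. *)
Lemma weyl (A B : 'M[H]_(m, n)) s s' k :
  is_singular_values A s -> is_singular_values B s' ->
  `|s 0 k - s' 0 k| <= weyl_const * mxfrob (A - B).
Proof.
move=> As Bs'.
have entry (r : 'rV[R]_(minn m n)) : r 0 k =
    \sum_l r 0 l * head_indicator k.+1 0 l - \sum_l r 0 l * head_indicator k 0 l.
  rewrite -sumrB (bigD1 k) //= !mxE ltnSn ltnn mulr1 mulr0 subr0.
  rewrite big1 ?addr0 // => l /negPf lk.
  by rewrite !mxE ltnS leq_eqVlt val_eqE lk subrr.
have h1 := head_sum_le k.+1 As Bs'; have h2 := head_sum_le k As Bs'.
have h3 := head_sum_le k.+1 Bs' As; have h4 := head_sum_le k Bs' As.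
rewrite mxfrobB in h3; rewrite mxfrobB in h4.
rewrite (entry s) (entry s') /weyl_const ler_norml.
move: h1 h2 h3 h4; set E := mxfrob _.
set s1 := \sum_l _; set s2 := \sum_l _; set s3 := \sum_l _; set s4 := \sum_l _.
set C := _%:R; move: (C * E) (mulrA 2 C E) => CE <-.
by move=> *; apply/andP; split; lra.
Qed.

Lemma singular_valuesP (A : 'M[H]_(m, n)) : is_singular_values A (singular_values A).
Proof. exact: xgetPex (singular_values_exist A). Qed.

Lemma singular_values_ge0 (A : 'M[H]_(m, n)) k : 0 <= singular_values A 0 k.
Proof. by case: (singular_valuesP A). Qed.

Lemma singular_values_lipschitz (A B : 'M[H]_(m, n)) k :
  `|singular_values A 0 k - singular_values B 0 k| <= weyl_const * mxfrob (A - B).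
Proof. exact: weyl (singular_valuesP A) (singular_valuesP B). Qed.

End RealDiagonal.
End SingularValues.

(** * Monotonicity, slope and continuity of the scalar surrogates *)

Section RegularScalarFunctions.
Variable R : realType.
Implicit Types phi : R -> R.

(* The consequences of concavity and monotonicity shared by all the surrogates
   and sufficient below; the slope may be infinite at [0], as for [x `^ p]. *)
Record surrogate_regular phi : Prop := SurrogateRegular {
  regular_mono : forall x y, 0 <= y -> y <= x -> phi y <= phi x ;
  regular_slope : forall a, 0 < a -> exists2 L, 0 <= L &
    forall x y, a <= y -> y <= x -> phi x - phi y <= L * (x - y) ;
  regular_cvg0 : forall e, 0 < e -> exists2 d, 0 < d &
    forall x, 0 <= x < d -> phi x - phi 0 < e
}.

Lemma lipschitz_regular phi L : 0 <= L ->
  (forall x y, 0 <= y -> y <= x -> phi y <= phi x) ->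
  (forall x y, 0 <= y -> y <= x -> phi x - phi y <= L * (x - y)) ->
  surrogate_regular phi.
Proof.
move=> L0 phi_mono phiL; split=> // [a a0|e e0].
  by exists L => // x y ay; apply: phiL; exact: le_trans (ltW a0) ay.
(* [L + 1] keeps the radius positive when [L = 0]. *)
exists (e / (L + 1)); first by rewrite divr_gt0 // ltr_wpDl.
move=> x /andP[x0]; rewrite ltr_pdivlMr ?ltr_wpDl // => xe.
by apply: le_lt_trans (phiL x 0 _ _) _ => //; nra.
Qed.

Lemma scale_regular phi w : 0 < w -> surrogate_regular phi ->
  surrogate_regular (fun x => w * phi x).
Proof.
move=> w0 [phi_mono phi_slope phi_cvg0]; split.
- by move=> x y y0 yx; rewrite ler_pM2l // phi_mono.
- move=> a /phi_slope[L L0 phiL]; exists (w * L); first by rewrite mulr_ge0 // ltW.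
  by move=> x y ay yx; rewrite -mulrBr -mulrA ler_pM2l // phiL.
- move=> e e0; have [|d d0 phid] := phi_cvg0 (e / w); first exact: divr_gt0.
  by exists d => // x xd; rewrite -mulrBr mulrC -ltr_pdivlMr // phid.
Qed.

Lemma powR_regular p : 0 < p < 1 -> surrogate_regular (fun x => x `^ p).
Proof.
move=> /andP[p0 p1]; split.
- by move=> x y y0 yx; rewrite (ge0_ler_powR (ltW p0)) ?nnegrE // (le_trans y0).
- move=> a a0; exists (a `^ (p - 1)); first exact: powR_ge0.
  have decr x y : 0 < y -> y <= x -> x `^ (p - 1) <= y `^ (p - 1).
    move=> y0 yx; have x0 := lt_le_trans y0 yx.
    rewrite -opprB !powRN lef_pV2 ?posrE ?powR_gt0 //.
    have q0 : 0 <= 1 - p by lra.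
    by rewrite (ge0_ler_powR q0) ?nnegrE ?(ltW y0) ?(ltW x0).
  move=> x y ay yx; have y0 := lt_le_trans a0 ay; have x0 := lt_le_trans y0 yx.
  (* Each power is factored as its base times a power of exponent [p - 1]; this decreasing factor at
     [x] is bounded by its value at [y], and that one by its value at [a]. *)
  rewrite -(mulr_powRB1 (ltW x0) p0) -(mulr_powRB1 (ltW y0) p0).
  have := decr _ _ y0 yx; have := decr _ _ a0 ay; nra.
- move=> e e0; exists (e `^ p^-1); first by rewrite powR_gt0.
  move=> x /andP[x0 xe]; rewrite powR0 ?gt_eqF // subr0.
  have -> : e = (e `^ p^-1) `^ p by rewrite -powRrM mulVf ?gt_eqF // powRr1 // ltW.
  by rewrite gt0_ltr_powR // nnegrE ?powR_ge0.
Qed.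

(** The Lipschitz constants are slopes at [0], where a concave function is steepest; the two power
    surrogates have infinite slope there and go through [powR_regular]. *)
Lemma surrogate_fun_regular (f : surrogate R) gamma i :
  0 < gamma -> surrogate_ok f -> surrogate_regular (surrogate_fun f gamma i).
Proof.
move=> g0; case: f => [||| w|p|w p] /=.
- move=> _; have diffE x y : 0 <= x -> 0 <= y ->
      (1 + gamma) * x / (x + gamma) - (1 + gamma) * y / (y + gamma) =
      (1 + gamma) * (gamma * (x - y)) / ((x + gamma) * (y + gamma)).
    move=> x0 y0; have yg : 0 < y + gamma by lra.
    have xg : 0 < x + gamma by lra.
    by field; rewrite !gt_eqF.
  apply: (@lipschitz_regular _ ((1 + gamma) / gamma)).
  + by rewrite divr_ge0 ?addr_ge0 // ltW.
  + move=> x y y0 yx; have x0 := le_trans y0 yx.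
    rewrite -subr_ge0 diffE // divr_ge0 ?mulr_ge0 ?subr_ge0 //; lra.
  + move=> x y y0 yx; have x0 := le_trans y0 yx; rewrite diffE //.
    have yg : 0 < y + gamma by lra.
    have xg : 0 < x + gamma by lra.
    rewrite ler_pdivrMr ?mulr_gt0 //.
    have -> : (1 + gamma) / gamma * (x - y) * ((x + gamma) * (y + gamma)) =
        (1 + gamma) * (x - y) / gamma * ((x + gamma) * (y + gamma)) by ring.
    have h : gamma * gamma <= (x + gamma) * (y + gamma).
      by apply: ler_pM; lra.
    apply: (@le_trans _ _ ((1 + gamma) * (x - y) / gamma * (gamma * gamma))).
      by rewrite le_eqVlt; apply/orP; left; apply/eqP; field; rewrite gt_eqF.
    by apply: ler_wpM2l h; rewrite divr_ge0 ?mulr_ge0 ?subr_ge0 //; lra.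
- move=> _; apply: (@lipschitz_regular _ gamma^-1).
  + by rewrite invr_ge0 ltW.
  + by move=> x y y0 yx; rewrite lerD2l lerN2 ler_expR ler_pM2r ?invr_gt0 // lerN2.
  + move=> x y y0 yx; have e1 := expR_ge1Dx (- (x - y) / gamma).
    have e2 : expR (- x / gamma) = expR (- y / gamma) * expR (- (x - y) / gamma).
      by rewrite -expRD; congr expR; ring.
    have e3 : expR (- y / gamma) <= 1.
      by rewrite -expR0 ler_expR mulNr oppr_le0 divr_ge0 // ltW.
    have e4 := expR_gt0 (- y / gamma).
    have e5 : 0 <= (x - y) / gamma by rewrite divr_ge0 ?subr_ge0 // ltW.
    rewrite /= e2 (mulrC gamma^-1); move: e1; rewrite [- (x - y) / _]mulNr.
    move: (expR (- y / gamma)) (expR _) ((x - y) / gamma) e3 e4 e5 => u v t *.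
    nra.
- move=> _; apply: (@lipschitz_regular _ gamma^-1).
  + by rewrite invr_ge0 ltW.
  + by move=> x y y0 yx; rewrite ler_ln ?posrE; lra.
  + move=> x y y0 yx; have yg : 0 < gamma + y by lra.
    have xg : 0 < gamma + x by lra.
    rewrite -ln_div ?posrE //.
    have -> : (gamma + x) / (gamma + y) = 1 + (x - y) / (gamma + y).
      by field; rewrite gt_eqF.
    have t0 : 0 <= (x - y) / (gamma + y) by rewrite divr_ge0 ?subr_ge0 // ltW.
    apply: (@le_trans _ _ ((x - y) / (gamma + y))); first by apply: le_ln1Dx; lra.
    rewrite mulrC ler_wpM2r ?subr_ge0 // lef_pV2 ?posrE //; lra.
- move=> w0; apply: scale_regular => //.
  by apply: (@lipschitz_regular _ 1) => // x y _ _; rewrite mul1r.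
- exact: powR_regular.
- by move=> [w0 p01]; apply: scale_regular => //; exact: powR_regular.
Qed.

Section Consequences.
Variable phi : R -> R.
Hypothesis phi_reg : surrogate_regular phi.

(** By monotonicity only [y < s] matters. The slope bound handles [y >= s / 2]; below [s / 2] the
    drop is at most [phi s - phi 0], over a distance of at least [s / 2]. At [s = 0] there is no
    drop, so an infinite slope there does no harm. *)
Lemma regular_calm (s : R) : 0 <= s ->
  exists2 L, 0 <= L & forall y, 0 <= y -> phi s - phi y <= L * `|s - y|.
Proof.
have [phi_mono phi_slope _] := phi_reg.
rewrite le_eqVlt => /orP[/eqP <-|s0].
  by exists 0 => // y y0; rewrite mul0r subr_le0 phi_mono.
have [|L L0 phiL] := phi_slope (s / 2); first by rewrite divr_gt0.
have s2 : 0 < s / 2 by rewrite divr_gt0.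
have K0 : 0 <= (phi s - phi 0) / (s / 2).
  by rewrite divr_ge0 ?(ltW s2) // subr_ge0 phi_mono // ltW.
exists (L + (phi s - phi 0) / (s / 2)); first exact: addr_ge0.
move=> y y0; have [sy|ys] := leP s y.
  apply: (@le_trans _ _ 0); first by rewrite subr_le0 phi_mono // ltW.
  by rewrite mulr_ge0 ?addr_ge0.
rewrite ger0_norm ?subr_ge0 ?(ltW ys) //.
have [y2|y2] := leP (s / 2) y.
  apply: le_trans (phiL _ _ y2 (ltW ys)) _.
  by rewrite ler_wpM2r ?subr_ge0 ?(ltW ys) // lerDl.
apply: (@le_trans _ _ (phi s - phi 0)); first by rewrite lerD2l lerN2 phi_mono.
rewrite mulrDl; apply: ler_wpDl; first by rewrite mulr_ge0 // subr_ge0 ltW.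
apply: (@le_trans _ _ ((phi s - phi 0) / (s / 2) * (s / 2))).
  by rewrite divfK // gt_eqF.
by rewrite ler_wpM2l //; lra.
Qed.

(** The additive [1] absorbs the variation on [[0, 1]], where the slope may be unbounded; beyond [1]
    the slope is bounded. *)
Lemma regular_coarse :
  exists2 C, 0 <= C & forall x y, 0 <= x -> 0 <= y -> phi x - phi y <= C * (1 + `|x - y|).
Proof.
have [phi_mono phi_slope _] := phi_reg.
have [//|L L0 phiL] := phi_slope 1.
have K0 : 0 <= phi 1 - phi 0 by rewrite subr_ge0 phi_mono.
exists (L + (phi 1 - phi 0)); first exact: addr_ge0.
move=> x y x0 y0; have [xy|yx] := leP x y.
  apply: (@le_trans _ _ 0); first by rewrite subr_le0 phi_mono.
  by rewrite mulr_ge0 //; apply: addr_ge0.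
rewrite ger0_norm ?subr_ge0 ?(ltW yx) //.
have phi0y := phi_mono _ _ (lexx 0) y0.
have [x1|x1] := leP x 1.
  by have := phi_mono _ _ x0 x1; nra.
have [y1|y1] := leP 1 y.
  by have := phiL _ _ y1 (ltW yx); nra.
by have := phiL _ _ (lexx 1) (ltW x1); nra.
Qed.

(** At [0] this is [regular_cvg0]; at [s > 0], calmness controls the values below [phi s] and the
    slope bound those above. *)
Lemma regular_continuous (x : nat -> R) (s : R) : (forall j, 0 <= x j) -> 0 <= s ->
  x j @[j --> \oo] --> s -> phi (x j) @[j --> \oo] --> phi s.
Proof.
have [phi_mono phi_slope phi_cvg0] := phi_reg.
move=> x0 s0 xs; move: (s0) xs; rewrite le_eqVlt => /orP[/eqP <-|s_gt0] xs.
  apply/cvgrPdist_lt => e /phi_cvg0[d d0 phid].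
  move/cvgrPdist_lt/(_ d d0) : xs; apply: filterS => j.
  rewrite distrC subr0 ger0_norm // => xd; rewrite distrC ger0_norm.
    by apply: phid; rewrite x0.
  by rewrite subr_ge0 phi_mono.
have [L L0 phiL] := regular_calm s0; have [K K0 phiK] := phi_slope _ s_gt0.
apply: (cvg_dist_le (e := fun j => (L + K) * `|x j - s|)) => [j|].
  have := phiL _ (x0 j); rewrite (distrC s) => h.
  have t0 : 0 <= L * `|x j - s| by rewrite mulr_ge0.
  have t1 : 0 <= K * `|x j - s| by rewrite mulr_ge0.
  rewrite mulrDl; have [sx|xlts] := leP s (x j).
    have := phiK _ _ (lexx s) sx; have := phi_mono _ _ s0 sx.
    rewrite -{1}(ger0_norm (x := x j - s)) ?subr_ge0 // => h1 h2.
    by rewrite ger0_norm ?subr_ge0 //; lra.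
  have := phi_mono _ _ (x0 j) (ltW xlts) => h1.
  by rewrite distrC ger0_norm ?subr_ge0 //; lra.
rewrite -(mulr0 (L + K)); apply: cvgMr; rewrite -(normr0 R).
by apply: cvg_norm; exact/subr_cvg0.
Qed.

End Consequences.
End RegularScalarFunctions.

(** * Calmness, growth and continuity of the surrogate norm *)

Section SurrogateNorm.
Variable R : realType.
Local Notation H := (quat R).
Variables (phi : surrogate R) (gamma : R) (m n : nat).
Hypotheses (gamma_gt0 : 0 < gamma) (phi_ok : surrogate_ok phi).
Implicit Types X Y : 'M[H]_(m, n).
Local Notation f := (surrogate_norm phi gamma : 'M[H]_(m, n) -> R).

Let phi_reg i : surrogate_regular (surrogate_fun phi gamma i).
Proof. exact: surrogate_fun_regular. Qed.

Lemma weyl_const_ge0 : 0 <= weyl_const R m n.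
Proof. by rewrite mulr_ge0. Qed.

Lemma surrogate_norm_calm X :
  exists2 L, 0 <= L & forall Y, f X - f Y <= L * mxfrob (X - Y).
Proof.
have /choice[L LP] : forall i : 'I_(minn m n), exists L, 0 <= L /\ forall y, 0 <= y ->
    surrogate_fun phi gamma i (singular_values X 0 i) - surrogate_fun phi gamma i y
    <= L * `|singular_values X 0 i - y|.
  move=> i; have [L L0 XL] := regular_calm (phi_reg i) (singular_values_ge0 X i).
  by exists L.
exists (\sum_i L i * weyl_const R m n).
  by apply: sumr_ge0 => i _; rewrite mulr_ge0 ?weyl_const_ge0 //; case: (LP i).
move=> Y; rewrite /surrogate_norm -sumrB mulr_suml; apply: ler_sum => i _.
have [L0 XL] := LP i; apply: le_trans (XL _ (singular_values_ge0 Y i)) _.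
by rewrite -mulrA ler_wpM2l // singular_values_lipschitz.
Qed.

Lemma surrogate_norm_coarse :
  exists2 C, 0 <= C & forall X Y, f X - f Y <= C * (1 + mxfrob (X - Y)).
Proof.
have /choice[C CP] : forall i : 'I_(minn m n), exists C, 0 <= C /\
    forall x y, 0 <= x -> 0 <= y ->
    surrogate_fun phi gamma i x - surrogate_fun phi gamma i y <= C * (1 + `|x - y|).
  by move=> i; have [C C0 phiC] := regular_coarse (phi_reg i); exists C.
have W0 := weyl_const_ge0.
exists (\sum_i C i * (1 + weyl_const R m n)).
  by apply: sumr_ge0 => i _; rewrite mulr_ge0 ?addr_ge0 //; case: (CP i).
move=> X Y; rewrite /surrogate_norm -sumrB mulr_suml; apply: ler_sum => i _.
have [C0 phiC] := CP i.
apply: le_trans (phiC _ _ (singular_values_ge0 X i) (singular_values_ge0 Y i)) _.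
rewrite -mulrA ler_wpM2l //; have := singular_values_lipschitz X Y i.
by have := mxfrob_ge0 (X - Y); nra.
Qed.

Lemma surrogate_norm_continuous (X : nat -> 'M[H]_(m, n)) L : mxcvg X L ->
  f (X j) @[j --> \oo] --> f L.
Proof.
move=> XL; apply: cvg_sum_real => i; apply: regular_continuous.
- exact: phi_reg.
- by move=> j; exact: singular_values_ge0.
- exact: singular_values_ge0.
- apply: (cvg_dist_le (fun j => singular_values_lipschitz (X j) L i)).
  by rewrite -(mulr0 (weyl_const R m n)); exact: cvgMr.
Qed.

End SurrogateNorm.

(** * Subgradients from quadratically penalised minimisation *)

Section Variational.
Variable R : realType.
Local Notation H := (quat R).
Variables (m n : nat) (f : 'M[H]_(m, n) -> R).
Implicit Types (X Y Q M V : 'M[H]_(m, n)).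

Lemma mxfrob_sqrB X Y : mxfrob (X - Y) ^+ 2 =
  mxfrob X ^+ 2 - 2 * q1 (mxinner X Y) + mxfrob Y ^+ 2.
Proof.
rewrite mxfrob_sqrD mxfrobN; congr (_ + _ + _); rewrite -mulrN; congr (_ * _).
rewrite !q1_mxinner -sumrN; apply: eq_bigr => i _; rewrite -sumrN.
by apply: eq_bigr => j _; rewrite mxE /=; ring.
Qed.

(** Expanding the square around [Q] exhibits the linear term; the remainder
    [c * mxfrob (Y - Q) ^+ 2] is at most [e * mxfrob (Y - Q)] within distance [e / (c + 1)]. *)
Lemma prox_frechet_subdiff c M Q : 0 <= c ->
  (forall Y, f Q + c * mxfrob (M - Q) ^+ 2 <= f Y + c * mxfrob (M - Y) ^+ 2) ->
  frechet_subdiff f Q (realq (2 * c) *: (M - Q)).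
Proof.
move=> c0 Qmin e e0; exists (e / (c + 1)); first by rewrite divr_gt0 // ltr_wpDl.
move=> Y; rewrite ltr_pdivlMr ?ltr_wpDl // => Yd; have := Qmin Y.
have -> : M - Y = M - Q - (Y - Q) by rewrite opprB addrA subrK.
rewrite (mxfrob_sqrB (M - Q)) q1_mxinnerZl; have := mxfrob_ge0 (Y - Q).
set h := mxfrob (Y - Q) in Yd *; set v := q1 _ => h0.
have : c * h ^+ 2 <= e * h.
  by rewrite expr2 mulrA ler_wpM2r //; nra.
by move=> *; lra.
Qed.

Lemma cvg_mxfrob (X : nat -> 'M[H]_(m, n)) L :
  mxcvg X L -> mxfrob (X j) @[j --> \oo] --> mxfrob L.
Proof.
move=> /mxcvgP XL; rewrite mxfrob_sqrtE; under eq_fun do rewrite mxfrob_sqrtE.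
apply: cvg_sqrt; apply: cvg_sum_real => a; apply: cvg_sum_real => b.
have [c1 ci cj ck] := XL a b.
by apply: cvgD; [apply: cvgD; [apply: cvgD|]|]; exact: cvgM.
Qed.

Hypothesis f_cont : forall (X : nat -> 'M[H]_(m, n)) L, mxcvg X L ->
  f (X j) @[j --> \oo] --> f L.

(** Outside the ball of radius [L / c] about [X] the penalty outweighs the possible decrease of [f],
    so no point there beats [X]; a minimiser over the compact ball is therefore global. *)
Lemma penalized_argmin X L c : 0 < c -> 0 <= L ->
  (forall Y, f X - f Y <= L * mxfrob (X - Y)) ->
  exists2 Q, mxfrob (X - Q) <= L / c &
    forall Y, f Q + c * mxfrob (X - Q) ^+ 2 <= f Y + c * mxfrob (X - Y) ^+ 2.
Proof.
(* The variable is the displacement [Z = X - Y], and the sign turns the minimum into a maximum. *)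
move=> c0 L0 fL; pose g Z := - (f (X - Z) + c * mxfrob Z ^+ 2).
have r0 : 0 <= L / c by rewrite divr_ge0 // ltW.
have [||Z Zr Zmax] := @seq_compact_max R _ [set Z | mxfrob Z <= L / c] g.
- by exists 0; rewrite /= mxfrob0.
- move=> x xr; have [u u_incr [Z xZ]] := mx_bolzano_weierstrass xr.
  exists u => //; exists Z.
    apply: (ler_cvg_to (cvg_mxfrob xZ) (cvg_cst (L / c))).
    by apply: nearW => j; exact: xr.
  apply: cvgN; apply: cvgD.
    by apply: f_cont; apply: mxcvgD (mxcvg_cst _) _; exact: mxcvgN.
  by apply: cvgMr; apply: cvgM; exact: cvg_mxfrob.
exists (X - Z); first by rewrite subKr.
move=> Y; rewrite subKr.
have [Yr|Yr] := leP (mxfrob (X - Y)) (L / c).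
  by have := Zmax _ Yr; rewrite /g subKr lerN2.
have := Zmax 0; rewrite /g /= mxfrob0 subr0 lerN2 => /(_ r0) le0.
apply: le_trans le0 _; rewrite expr0n mulr0 addr0.
move: Yr; rewrite ltr_pdivrMr // => Yr; have := fL Y.
have := mxfrob_ge0 (X - Y); nra.
Qed.

Lemma limiting_subdiff_nonempty X L : 0 <= L ->
  (forall Y, f X - f Y <= L * mxfrob (X - Y)) -> exists V, limiting_subdiff f X V.
Proof.
move=> L0 fL.
have /choice[Y YP] : forall j : nat, exists Y, mxfrob (X - Y) <= L / j.+1%:R /\
    frechet_subdiff f Y (realq (2 * j.+1%:R) *: (X - Y)).
  move=> j; have [|Y Yr Ymin] := @penalized_argmin X L j.+1%:R _ L0 fL; first by [].
  by exists Y; split => //; exact: prox_frechet_subdiff.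
pose V j := realq (2 * j.+1%:R) *: (X - Y j).
(* The displacement is at most [L / j.+1] and its factor is [2 * j.+1], hence the bound [2 * L]. *)
have [j|u u_incr [W VW]] := @mx_bolzano_weierstrass _ _ _ V (2 * L).
  rewrite mxfrobZ ger0_norm // -mulrA ler_pM2l //.
  by have [+ _] := YP j; rewrite ler_pdivlMr // mulrC.
have YX : mxcvg Y X.
  apply: (cvg_dist_le (e := fun j => L * harmonic j)) => [j|].
    by rewrite subr0 ger0_norm ?mxfrob_ge0 // mxfrobB; case: (YP j).
  by rewrite -(mulr0 L); apply: cvgMr; exact: cvg_harmonic.
exists W, (Y \o u), (V \o u); split => //; first exact: mxcvg_subseq.
  by apply: f_cont; exact: mxcvg_subseq.
by move=> j; case: (YP (u j)).
Qed.

End Variational.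

(** * Growth of the penalty parameters *)

Section PenaltyParameters.
Variable R : realType.
Variables (rho : R) (bmax : \bar R) (beta : nat -> R).
Hypotheses (rho_gt1 : 1 < rho) (bmax_gt0 : (0 < bmax)%E) (beta0_gt0 : 0 < beta 0%N)
  (beta_step : forall t, (beta t.+1)%:E = Order.min bmax (rho * beta t)%:E).

Lemma penalty_gt0 t : 0 < beta t.
Proof.
elim: t => [|t IH]; first exact: beta0_gt0.
by rewrite -lte_fin beta_step lt_min bmax_gt0 lte_fin mulr_gt0 // (lt_trans ltr01).
Qed.

(* With a finite cap the parameters stay bounded, so the terms of the series do
   not tend to [0]. *)
Lemma penalty_geometric :
  (\sum_(1 <= t <oo) ((beta t + beta t.-1) / (2 * beta t.-1 ^+ 2))%:E < +oo)%E ->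
  forall t, beta t.+1 = rho * beta t.
Proof.
move=> sum_fin; have beta_gt0 := penalty_gt0.
have [bmaxE|bmax_fin] := eqVneq bmax +oo%E.
  by move=> t; have := beta_step t; rewrite bmaxE minye => -[].
exfalso; have [r bmaxE] : exists r, bmax = r%:E.
  by case: bmax bmax_gt0 bmax_fin => [r| |]// _ _; exists r.
pose M := beta 0%N + `|r|.
have beta_le t : beta t <= M.
  case: t => [|t]; first by rewrite lerDl.
  apply: (@le_trans _ _ r); last by rewrite /M ler_wpDl ?ler_norm // ltW.
  by rewrite -lee_fin beta_step bmaxE ge_min lexx.
have M_gt0 : 0 < M by rewrite ltr_pwDl.
(* Dropping [beta t] from the numerator leaves [1 / (2 * beta t.-1)], which is at least
   [1 / (2 * M)]. *)
have term_ge t : (1 <= t)%N ->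
    (2 * M)^-1 <= (beta t + beta t.-1) / (2 * beta t.-1 ^+ 2).
  case: t => // t _ /=; apply: (@le_trans _ _ (2 * beta t)^-1).
    by rewrite lef_pV2 ?posrE ?mulr_gt0 // ler_pM2l.
  have -> : (2 * beta t)^-1 = beta t / (2 * beta t ^+ 2) by field; rewrite gt_eqF.
  apply: ler_wpM2r; first by rewrite invr_ge0 mulr_ge0 ?sqr_ge0.
  by rewrite lerDr ltW.
have term_ge0 t : (1 <= t)%N ->
    (0 <= ((beta t + beta t.-1) / (2 * beta t.-1 ^+ 2))%:E)%E.
  by move=> t1; rewrite lee_fin (le_trans _ (term_ge t t1)) // invr_ge0 mulr_ge0 // ltW.
have M2_gt0 : 0 < (2 * M)^-1 by rewrite invr_gt0 mulr_gt0.
move: sum_fin; set S := (X in (X < _)%E) => S_fin.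
have part n : ((n%:R * (2 * M)^-1)%:E <= S)%E.
  apply: le_trans (nneseries_lim_ge n.+1 (fun t t1 _ => term_ge0 t t1)).
  rewrite sumEFin lee_fin mulr_natl.
  have -> : (2 * M)^-1 *+ n = \sum_(1 <= t < n.+1) (2 * M)^-1.
    by rewrite sumr_const_nat subSS subn0.
  by rewrite big_nat [leRHS]big_nat; apply: ler_sum => t /andP[t1 _]; exact: term_ge.
have S_ge0 : (0 <= S)%E by have := part 0%N; rewrite mul0r.
have S_num : S \is a fin_num by rewrite ge0_fin_numE.
have := part (Num.truncn (fine S * (2 * M))).+1.
rewrite -(fineK S_num) lee_fin ler_pdivrMr ?mulr_gt0 //.
by rewrite leNgt truncnS_gt.
Qed.

End PenaltyParameters.

(** Bernoulli's inequality bounds the sequence below by an affine one of positive slope. *)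
Lemma geometric_unbounded (R : realType) (rho : R) (beta : nat -> R) :
  1 < rho -> 0 < beta 0%N -> (forall t, beta t.+1 = rho * beta t) ->
  beta t @[t --> \oo] --> +oo.
Proof.
move=> rho1 b0 betaE.
have beta_ge t : beta 0%N * (1 + t%:R * (rho - 1)) <= beta t.
  elim: t => [|t IH]; first by rewrite mul0r addr0 mulr1.
  rewrite betaE -natr1; apply: (@le_trans _ _ (rho * (beta 0%N * (1 + t%:R * (rho - 1))))).
    have t0 : 0 <= t%:R :> R by [].
    have : 0 <= beta 0%N * (t%:R * (rho - 1) ^+ 2).
      by rewrite mulr_ge0 ?(ltW b0) // mulr_ge0 ?sqr_ge0.
    rewrite -subr_ge0 => h; rewrite -subr_ge0.
    by apply: le_trans h _; rewrite le_eqVlt; apply/orP; left; apply/eqP; ring.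
  by rewrite ler_pM2l // (lt_trans ltr01).
have h0 : 0 < beta 0%N * (rho - 1) by rewrite mulr_gt0 // subr_gt0.
apply/cvgryPge => A; near=> t; apply: le_trans (beta_ge t).
apply: (@le_trans _ _ (t%:R * (beta 0%N * (rho - 1)))).
  rewrite -ler_pdivrMr //; apply: le_trans (ler_norm _) _.
  by near: t; exact: nbhs_infty_ger.
by have := ltW b0; lra.
Unshelve. all: by end_near. Qed.

(** * One proximal step and the multiplier it produces *)

Section ProximalStep.
Variable R : realType.
Local Notation H := (quat R).
Variables (m n : nat) (f : 'M[H]_(m, n) -> R) (a b : R) (P Q F : 'M[H]_(m, n)).
Hypotheses (a_ge0 : 0 <= a) (b_gt0 : 0 < b)
  (Q_argmin : is_argmin (fun X =>
    a * f X + b / 2 * mxfrob (P - X + realq b^-1 *: F) ^+ 2) Q).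
Local Notation M := (P + realq b^-1 *: F).

Lemma prox_argmin Y : a * f Q + b / 2 * mxfrob (M - Q) ^+ 2 <=
  a * f Y + b / 2 * mxfrob (M - Y) ^+ 2.
Proof. by rewrite ![M - _]addrAC; exact: Q_argmin. Qed.

Lemma multiplier_update : F - realq b *: (Q - P) = realq b *: (M - Q).
Proof.
rewrite [M - Q]addrAC [RHS]scalerDr scalerA realqM mulfV ?gt_eqF //.
by rewrite -[realq 1]/(1 : H) scale1r -[P - Q]opprB scalerN [RHS]addrC.
Qed.

Lemma prox_distance C : (forall X Y, f X - f Y <= C * (1 + mxfrob (X - Y))) ->
  b / 2 * mxfrob (M - Q) ^+ 2 <= a * C * (1 + mxfrob (M - Q)).
Proof.
move=> fC; have := prox_argmin M; rewrite subrr mxfrob0 expr0n mulr0 addr0.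
by have := ler_wpM2l a_ge0 (fC M Q); rewrite -mulrA mulrBr; lra.
Qed.

Lemma multiplier_frechet : 0 < a ->
  frechet_subdiff f Q (realq a^-1 *: (F - realq b *: (Q - P))).
Proof.
move=> a_gt0; rewrite multiplier_update scale_realqA.
have -> : a^-1 * b = 2 * (b / 2 / a) by field; rewrite gt_eqF.
apply: prox_frechet_subdiff; first by rewrite !divr_ge0 // ltW.
have scale x : a * (b / 2 / a * x) = b / 2 * x by field; rewrite gt_eqF.
move=> Y; rewrite -(ler_pM2l a_gt0) !mulrDr !scale; exact: prox_argmin.
Qed.

(** Without the term in [f], the minimiser is the centre of the proximal term, so the displacement
    vanishes. *)
Lemma multiplier_eq0 : a = 0 -> F - realq b *: (Q - P) = 0.
Proof.
move=> a0; have := prox_argmin M.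
rewrite a0 !mul0r !add0r subrr mxfrob0 expr0n mulr0 pmulr_rle0 ?divr_gt0 //.
move=> le0; have : mxfrob (M - Q) ^+ 2 = 0 by apply/eqP; rewrite eq_le le0 sqr_ge0.
move/eqP; rewrite sqrf_eq0 => /eqP/mxfrob_eq0 MQ0.
by rewrite multiplier_update MQ0 scaler0.
Qed.

End ProximalStep.

(** While [d t >= e], both [1] and [d t] are dominated by multiples of [d t ^+ 2], so the hypothesis
    bounds [beta t] by [2 * K * (e^-1 ^+ 2 + e^-1)]; divergence eventually rules this out. *)
Lemma cvg0_of_sqr_le (R : realType) (beta d : nat -> R) K : 0 <= K ->
  (forall t, 0 <= d t) -> beta t @[t --> \oo] --> +oo ->
  (forall t, beta t / 2 * d t ^+ 2 <= K * (1 + d t)) ->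
  d t @[t --> \oo] --> (0 : R).
Proof.
move=> K0 d_ge0 beta_oo dK; apply/cvgrPdist_lt => e e0.
move/cvgryPgt/(_ (2 * K * (e^-1 ^+ 2 + e^-1))) : beta_oo.
apply: filterS => t beta_gt; rewrite sub0r normrN ger0_norm //.
rewrite ltNge; apply/negP => e_le; have := dK t; apply/negP; rewrite -ltNge.
have d_gt0 := lt_le_trans e0 e_le.
apply: (@le_lt_trans _ _ (K * (e^-1 ^+ 2 + e^-1) * d t ^+ 2)); last first.
  by rewrite ltr_pM2r ?exprn_gt0 // ltr_pdivlMr // mulrC mulrA.
rewrite -mulrA ler_wpM2l //.
have q1 : 1 <= d t / e by rewrite ler_pdivlMr // mul1r.
have -> : (e^-1 ^+ 2 + e^-1) * d t ^+ 2 = (d t / e) ^+ 2 + d t / e * d t by ring.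
by apply: lerD; [exact: exprn_ege1 | rewrite ler_peMl // ltW].
Qed.

(** * Vanishing of the feasibility gap *)

Section FeasibilityGap.
Variable R : realType.
Local Notation H := (quat R).
Variables (m n : nat) (f : 'M[H]_(m, n) -> R) (a C rho : R).
Variables (beta : nat -> R) (P Q F : nat -> 'M[H]_(m, n)).
Hypotheses (a_ge0 : 0 <= a) (C_ge0 : 0 <= C) (rho_gt1 : 1 < rho)
  (f_coarse : forall X Y, f X - f Y <= C * (1 + mxfrob (X - Y)))
  (beta_gt0 : forall t, 0 < beta t)
  (betaE : forall t, beta t.+1 = rho * beta t)
  (Q_argmin : forall t, is_argmin (fun X => a * f X +
    beta t / 2 * mxfrob (P t.+1 - X + realq (beta t)^-1 *: F t) ^+ 2) (Q t.+1))
  (F_step : forall t, F t.+1 = F t - realq (beta t) *: (Q t.+1 - P t.+1)).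

(* The multipliers need not be bounded, but [F t.+1 / beta t] is the proximal
   displacement, which tends to [0]. *)
Lemma feasibility_gap_cvg0 : mxcvg (fun t => P t - Q t) 0.
Proof.
pose D t := P t.+1 + realq (beta t)^-1 *: F t - Q t.+1.
have D0 : mxcvg D 0.
  rewrite /mxcvg; under eq_fun do rewrite subr0.
  apply: (@cvg0_of_sqr_le _ beta _ (a * C)); first exact: mulr_ge0.
  - by move=> t; exact: mxfrob_ge0.
  - exact: geometric_unbounded rho_gt1 (beta_gt0 _) betaE.
  - by move=> t; apply: (prox_distance a_ge0 (Q_argmin t)).
have FD t : F t.+1 = realq (beta t) *: D t.
  by rewrite F_step multiplier_update.
(* By [FD] and [betaE], [F t.+1 / beta t.+1] equals [D t / rho]; removing it from [D t.+1] leaves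
   the gap, which is thus described from index 2 on. *)
have gapE t : P t.+2 - Q t.+2 = D t.+1 - realq rho^-1 *: D t.
  rewrite /D FD scale_realqA betaE invfM -mulrA mulVf ?gt_eqF // mulr1.
  by rewrite /D; set x := realq _ *: _; rewrite addrAC addrK.
rewrite /mxcvg -(cvg_shiftn 2).
have shift2 : mxcvg (fun t => D t.+1 - realq rho^-1 *: D t) 0.
  rewrite -[0]subr0 -[X in _ - X](scaler0 _ (realq rho^-1)); apply: mxcvgD.
    by rewrite /mxcvg (cvg_shiftS (fun t => mxfrob (D t - 0))).
  by apply: mxcvgN; exact: mxcvgZ.
by under eq_fun do rewrite addn2 gapE.
Qed.

End FeasibilityGap.

(** * Convergence of tensors, by entries and through unfoldings *)

Section TensorConvergence.
Variables (R : realType) (N : nat) (I : 'I_N -> nat).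
Implicit Types X L : tensor R I.

Lemma absq_le_tfrob X i : absq (X i) <= tfrob X.
Proof.
rewrite ler_wsqrtr // q1_sum (bigD1 i) // q1_conjM lerDl.
by apply: sumr_ge0 => j _; rewrite q1_conjM sqnormq_ge0.
Qed.

Lemma tcvg_entry (X : nat -> tensor R I) L i : tcvg X L -> qcvg (fun j => X j i) (L i).
Proof.
move=> XL; apply/qcvg_absq; apply: cvg_dist_le XL => j.
rewrite subr0 ger0_norm ?absq_ge0 //.
by have := absq_le_tfrob (X j - L) i; rewrite !ffunE.
Qed.

Lemma tcvg_unfold (X : nat -> tensor R I) L k :
  tcvg X L -> mxcvg (fun j => unfold k (X j)) (unfold k L).
Proof.
move=> XL; apply/mxcvgP => a c; rewrite mxE.
by under eq_fun do rewrite mxE; exact: tcvg_entry.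
Qed.

End TensorConvergence.

Unset Implicit Arguments.
Set Strict Implicit.

Theorem theorem3p3 (R : realType) (N : nat) (I : 'I_N -> nat)
    (O : tensor R I) (Omega : {set mindex I}) (alpha : 'I_N -> R)
    (phi : surrogate R) (gamma rho : R) (bmax : \bar R)
    (P : nat -> tensor R I)
    (Q F : forall k : 'I_N, nat -> 'M[quat R]_(I k, #|coindex I k|))
    (beta : 'I_N -> nat -> R)
    (Ps : tensor R I)
    (Qs Fs : forall k : 'I_N, 'M[quat R]_(I k, #|coindex I k|))
    (alpha_ge0 : forall k, 0 <= alpha k)
    (alpha_sum : \sum_k alpha k = 1)
    (gamma_gt0 : 0 < gamma)
    (phi_ok : surrogate_ok phi)
    (rho_gt1 : 1 < rho)
    (bmax_gt0 : (0 < bmax)%E)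
    (algo : lrqtc_nctr O Omega alpha phi gamma rho bmax P Q F beta)
    (beta_cond : forall k,
      (\sum_(1 <= t <oo) ((beta k t + beta k t.-1)
                            / (2 * beta k t.-1 ^+ 2))%:E < +oo)%E)
    (accu : accumulation_point P Q F Ps Qs Fs) :
  [/\ forall k, unfold k Ps = Qs k,
      tproj Omega Ps = tproj Omega O
    & forall k, exists2 V,
        limiting_subdiff (surrogate_norm phi gamma) (Qs k) V
        & Fs k = realq (alpha k) *: V].
Proof.
have [beta0 stepP stepQ stepF stepb] := algo.
have [u u_incr [PPs QQs FFs]] := accu.
have beta_gt0 k := penalty_gt0 rho_gt1 bmax_gt0 (beta0 k) (fun t => stepb t k).
have betaE k := penalty_geometric rho_gt1 bmax_gt0 (beta0 k) (fun t => stepb t k)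
  (beta_cond k).
have f_cont k := @surrogate_norm_continuous R phi gamma (I k) #|coindex I k|
  gamma_gt0 phi_ok.
(* Dropping the first term makes every index positive, so each iterate along [v] is the output of an
   iteration and satisfies its optimality conditions. *)
pose v j := u j.+1.
have v_incr : {homo v : a b / (a < b)%N} by move=> a b ab; exact: u_incr.
have v_gt0 j : v j = (v j).-1.+1.
  by rewrite prednK // (leq_ltn_trans _ (u_incr 0 j.+1 _)).
have tail m n (X : nat -> 'M[quat R]_(m, n)) L : mxcvg (X \o u) L -> mxcvg (X \o v) L.
  by rewrite /mxcvg -cvg_shiftS.
split.
- move=> k; have [C C0 f_coarse] := @surrogate_norm_coarse R phi gamma (I k)
    #|coindex I k| gamma_gt0 phi_ok.
  have gap0 := @feasibility_gap_cvg0 R _ _ (surrogate_norm phi gamma) (alpha k) C rho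
    (beta k) (fun t => unfold k (P t)) (Q k) (F k) (alpha_ge0 k) C0 rho_gt1
    f_coarse (beta_gt0 k) (betaE k) (fun t => stepQ t k) (fun t => stepF t k).
  apply/eqP; rewrite -subr_eq0; apply/eqP.
  (* Along [u] the gap tends both to [0] and to [unfold k Ps - Qs k]. *)
  apply: mxcvg_unique (mxcvg_subseq u_incr gap0).
  exact: mxcvgD (tcvg_unfold k PPs) (mxcvgN (QQs k)).
- apply/ffunP => i; rewrite !ffunE; case: ifP => // iO.
  (* After the first iteration the observed entries are those of [O], so the sequence is constant
     there. *)
  have PvPs : tcvg (P \o v) Ps by move: PPs; rewrite /tcvg -cvg_shiftS.
  apply: qcvg_unique (tcvg_entry i PvPs) _.
  rewrite (_ : (fun _ => _) = fun=> O i); first exact: qcvg_cst.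
  apply/funext => j /=; rewrite v_gt0; have [P' _ ->] := stepP (v j).-1.
  by rewrite !ffunE finset.in_setC iO add0r.
- move=> k; have [a0|a_neq0] := eqVneq (alpha k) 0.
    (* With zero weight every updated multiplier vanishes, hence so does the limit; any limiting
       subgradient then serves as [V]. *)
    have [L L0 fL] := surrogate_norm_calm gamma_gt0 phi_ok (Qs k).
    have [V fV] := limiting_subdiff_nonempty (f_cont k) L0 fL.
    exists V => //; rewrite a0 -[realq 0]/(0 : quat R) scale0r.
    apply: mxcvg_unique (tail _ _ _ _ (FFs k)) _.
    rewrite (_ : _ \o v = fun=> 0); first exact: mxcvg_cst.
    apply/funext => j /=; rewrite v_gt0 stepF.
    exact: multiplier_eq0 (beta_gt0 _ _) (stepQ _ k) a0.
  have a_gt0 : 0 < alpha k by rewrite lt_neqAle eq_sym a_neq0 alpha_ge0.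
  exists (realq (alpha k)^-1 *: Fs k); last first.
    by rewrite scale_realqA mulfV // -[realq 1]/(1 : quat R) scale1r.
  (* The scaled multipliers are Frechet subgradients at the iterates themselves; the values of the
     surrogate norm converge by its continuity. *)
  exists (Q k \o v), (fun j => realq (alpha k)^-1 *: F k (v j)); split.
  + exact: tail.
  + by apply: f_cont; exact: tail.
  + move=> j /=; rewrite v_gt0 stepF.
    exact: multiplier_frechet (beta_gt0 _ _) (stepQ _ k) a_gt0.
  + by apply: mxcvgZ; exact: tail.
Qed.
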